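(* Let $m\ge 3$, $d\ge 5$ and $3\le t\le d$ be integers, and let $X=\nu_d(\mathbb{P}^m)\subset\mathbb{P}^N$, $N=\binom{m+d}{m}-1$, be the order $d$ Veronese variety. Let $L\subset\mathbb{P}^m$ be a line, let $A_1\subset L$ be a connected subscheme of degree $2$ and let $A_2\subset\mathbb{P}^m\setminus L$ be a reduced finite set with $\sharp(A_2)=t-2$ such that $h^1(\mathbb{P}^m,\mathcal{I}_A(d))=0$, where $A:=A_1\cup A_2$. Set $Z_i:=\nu_d(A_i)$, $i=1,2$, and $Z:=Z_1\cup Z_2$. Assume that $A$ is in linearly general position in $\mathbb{P}^m$. Let $P\in\langle Z\rangle$ be such that $P\notin\langle Z'\rangle$ for any $Z'\subsetneq Z$. Then $b_X(P)=t$ and $r_X(P)=d+t-2$.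
   Context: The base field is algebraically closed of characteristic zero. $\nu_d$ is the order $d$ Veronese embedding. For a closed subscheme $Z\subset\mathbb{P}^N$, $\langle Z\rangle$ is its linear span (the smallest linear subspace containing $Z$ as a subscheme). $r_X(P)$ is the minimal cardinality of a finite set $S\subset X$ with $P\in\langle S\rangle$. $\sigma_k(X)$ is the Zariski closure of the union of the linear spans of $k$ points of $X$, and the border rank $b_X(P)$ is the minimal $k$ with $P\in\sigma_k(X)$. A $0$-dimensional scheme $A\subset\mathbb{P}^m$ is in linearly general position if $\deg(A\cap H)\le\dim(H)+1$ for every proper linear subspace $H\subsetneq\mathbb{P}^m$. *)

(* Defs.v *)
From HB Require Import structures.
From mathcomp Require Import all_boot all_order all_algebra.
From mathcomp Require Import mpoly.

Set Implicit Arguments.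
Unset Strict Implicit.
Unset Printing Implicit Defensive.

Import GRing.Theory.
Local Open Scope ring_scope.

(** Conventions.  K is algebraically closed throughout.  A point of P^n is a
    line of K^(n+1).  A closed subscheme of P^n = Proj K[x_0..x_n] is given by
    its unique saturated homogeneous ideal, so B is a closed subscheme of C
    exactly when the ideal of C is contained in the ideal of B.  The ideal of
    the empty scheme is the whole ring. *)

Section Points.
Variables (K : closedFieldType) (n : nat).

Record ppoint :=
  PPoint { line_of :> {vspace 'rV[K]_n.+1}; _ : \dim line_of == 1%N }.

HB.instance Definition _ := [isSub for line_of].
HB.instance Definition _ := [Equality of ppoint by <:].
HB.instance Definition _ := [Choice of ppoint by <:].

Lemma dim_ppoint (p : ppoint) : \dim p = 1%N.
Proof. by case: p => V /= /eqP. Qed.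

Lemma span1_ppoint_subproof (v : 'rV[K]_n.+1) :
  v != 0 -> \dim <[v]>%VS == 1%N.
Proof. by move=> nz_v; rewrite dim_vline nz_v. Qed.

Definition ppoint_of (v : 'rV[K]_n.+1) (nz_v : v != 0) : ppoint :=
  PPoint (span1_ppoint_subproof nz_v).

Lemma vpick_ppoint_neq0 (p : ppoint) : vpick p != 0.
Proof. by rewrite vpick0 -dimv_eq0 dim_ppoint. Qed.

Definition vanishes_at (f : {mpoly K[n.+1]}) (p : ppoint) : Prop :=
  forall v, v \in line_of p -> v != 0 -> f.@[fun i => v ord0 i] = 0.

End Points.

Section Subschemes.
Variables (K : closedFieldType) (n : nat).
Local Notation S := {mpoly K[n.+1]}.

Record subscheme := Subscheme {
  ideal_of : S -> Prop;
  ideal0 : ideal_of 0;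
  idealD : forall f g, ideal_of f -> ideal_of g -> ideal_of (f + g);
  idealM : forall a f, ideal_of f -> ideal_of (a * f);
  ideal_homog : forall f e, ideal_of f -> ideal_of (pihomog mdeg e f);
  ideal_saturated : forall f,
    (forall i : 'I_n.+1, exists k, ideal_of ('X_i ^+ k * f)) -> ideal_of f }.

Definition sub_scheme (B C : subscheme) : Prop :=
  forall f, ideal_of C f -> ideal_of B f.

Definition proper_sub_scheme (B C : subscheme) : Prop :=
  sub_scheme B C /\ ~ sub_scheme C B.

Definition on_scheme (C : subscheme) (p : ppoint K n) : Prop :=
  forall f, ideal_of C f -> vanishes_at f p.

Lemma pihomog_XM (m : 'X_{1..n.+1}) (f : S) (e : nat) :
  pihomog mdeg e ('X_[m] * f) =
  if (mdeg m <= e)%N then 'X_[m] * pihomog mdeg (e - mdeg m) f else 0.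
Proof.
rewrite {1}(mpolyE f) mulr_sumr raddf_sum /=.
case: leqP => [le_me|lt_em].
  rewrite pihomogE [in RHS]mulr_sumr [in RHS]big_mkcond /=.
  apply: eq_bigr => m' _.
  rewrite -scalerAr -mpolyXD linearZ /= pihomogX /= mdegD.
  have -> : (mdeg m + mdeg m' == e)%N = (mdeg m' == e - mdeg m)%N.
    by rewrite -{1}(subnKC le_me) eqn_add2l.
  by case: ifP => _; rewrite ?scaler0 // -scalerAr mpolyXD.
apply: big1 => m' _; rewrite -scalerAr -mpolyXD linearZ /= pihomogX /= mdegD.
case: eqP => [E|_]; last by rewrite scaler0.
by move: lt_em; rewrite -E ltnNge leq_addr.
Qed.

Lemma pihomog_XnM (i : 'I_n.+1) (k e : nat) (f : S) :
  pihomog mdeg (k + e) ('X_i ^+ k * f) = 'X_i ^+ k * pihomog mdeg e f.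
Proof.
by rewrite mpolyXn pihomog_XM mdegMn mdeg1 mul1n leq_addr addKn.
Qed.

(** The subscheme whose ideal is generated by the homogeneous elements of J. *)
Section FromForms.
Context (J : S -> Prop) (J0 : J 0)
  (JD : forall f g, J f -> J g -> J (f + g))
  (JM : forall a f, J f -> J (a * f))
  (Jsat : forall f, (forall i : 'I_n.+1, exists k, J ('X_i ^+ k * f)) -> J f).

Definition forms_ideal (f : S) : Prop := forall e, J (pihomog mdeg e f).

Fact forms_ideal0 : forms_ideal 0. Proof. by move=> e; rewrite raddf0. Qed.

Fact forms_idealD f g : forms_ideal f -> forms_ideal g -> forms_ideal (f + g).
Proof. by move=> If Ig e; rewrite raddfD /=; apply: JD. Qed.

Fact forms_idealM a f : forms_ideal f -> forms_ideal (a * f).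
Proof.
move=> If; rewrite (mpolyE a) mulr_suml.
elim/big_ind: _ => [||m _]; first exact: forms_ideal0.
  exact: forms_idealD.
move=> e.
rewrite -scalerAl linearZ /= pihomog_XM -mul_mpolyC; apply: JM.
by case: ifP => _ //; apply: JM.
Qed.

Fact forms_ideal_homog f e : forms_ideal f -> forms_ideal (pihomog mdeg e f).
Proof.
move=> If e'; have [<-|ne] := eqVneq e e'; first by rewrite pihomog_id.
by rewrite (pihomog_ne0 ne) //; apply: pihomogP.
Qed.

Fact forms_ideal_saturated f :
  (forall i : 'I_n.+1, exists k, forms_ideal ('X_i ^+ k * f)) ->
  forms_ideal f.
Proof.
move=> H e; apply: Jsat => i; have [k Hk] := H i; exists k.
by rewrite -pihomog_XnM; apply: Hk.
Qed.

Definition forms_scheme : subscheme := 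
  Subscheme forms_ideal0 forms_idealD forms_idealM forms_ideal_homog
    forms_ideal_saturated.

End FromForms.

Section Operations.
Variables B C : subscheme.

Definition union_ideal (f : S) : Prop := ideal_of B f /\ ideal_of C f.
Fact union_ideal0 : union_ideal 0. Proof. by split; apply: ideal0. Qed.
Fact union_idealD f g : union_ideal f -> union_ideal g -> union_ideal (f + g).
Proof. by case=> ? ? [? ?]; split; apply: idealD. Qed.
Fact union_idealM a f : union_ideal f -> union_ideal (a * f).
Proof. by case=> ? ?; split; apply: idealM. Qed.
Fact union_ideal_homog f e : union_ideal f -> union_ideal (pihomog mdeg e f).
Proof. by case=> ? ?; split; apply: ideal_homog. Qed.
Fact union_ideal_saturated f :
  (forall i : 'I_n.+1, exists k, union_ideal ('X_i ^+ k * f)) ->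
  union_ideal f.
Proof.
by move=> H; split; apply: ideal_saturated => i; have [k []] := H i; exists k.
Qed.

Definition union_scheme : subscheme := 
  Subscheme union_ideal0 union_idealD union_idealM union_ideal_homog
    union_ideal_saturated.

Definition sum_ideal (f : S) : Prop :=
  exists g h, [/\ ideal_of B g, ideal_of C h & f = g + h].
Fact sum_idealM a f : sum_ideal f -> sum_ideal (a * f).
Proof.
case=> g [h [Bg Ch ->]]; exists (a * g), (a * h).
by split; [exact: idealM | exact: idealM | rewrite mulrDr].
Qed.

(** The saturation of the sum of the two ideals. *)
Definition inter_ideal (f : S) : Prop :=
  forall i : 'I_n.+1, exists k, sum_ideal ('X_i ^+ k * f).
Fact inter_ideal0 : inter_ideal 0.
Proof.
move=> i; exists 0%N, 0, 0.
by split; [exact: ideal0 | exact: ideal0 | rewrite mulr0 addr0].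
Qed.
Fact inter_idealD f g : inter_ideal f -> inter_ideal g -> inter_ideal (f + g).
Proof.
move=> Mf Mg i; have [k sf] := Mf i; have [l sg] := Mg i.
exists (l + k)%N.
have -> : 'X_i ^+ (l + k) * (f + g) =
          'X_i ^+ l * ('X_i ^+ k * f) + 'X_i ^+ k * ('X_i ^+ l * g).
  by rewrite mulrDr !mulrA -!exprD (addnC k).
have [g1 [h1 [? ? ->]]] := sum_idealM ('X_i ^+ l) sf.
have [g2 [h2 [? ? ->]]] := sum_idealM ('X_i ^+ k) sg.
exists (g1 + g2), (h1 + h2).
by split; [exact: idealD | exact: idealD | rewrite addrACA].
Qed.
Fact inter_idealM a f : inter_ideal f -> inter_ideal (a * f).
Proof.
move=> Mf i; have [k sf] := Mf i; exists k.
by rewrite mulrCA; apply: sum_idealM.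
Qed.
Fact inter_ideal_homog f e : inter_ideal f -> inter_ideal (pihomog mdeg e f).
Proof.
move=> Mf i; have [k [g [h [Bg Ch E]]]] := Mf i; exists k.
exists (pihomog mdeg (k + e) g), (pihomog mdeg (k + e) h).
by rewrite -pihomog_XnM E raddfD; split=> //; apply: ideal_homog.
Qed.
Fact inter_ideal_saturated f :
  (forall i : 'I_n.+1, exists k, inter_ideal ('X_i ^+ k * f)) ->
  inter_ideal f.
Proof.
move=> H i; have [k Mk] := H i; have [l sl] := Mk i.
by exists (l + k)%N; rewrite exprD -mulrA.
Qed.

Definition inter_scheme : subscheme := 
  Subscheme inter_ideal0 inter_idealD inter_idealM inter_ideal_homog
    inter_ideal_saturated.

End Operations.

Section Closure.
Variable U : ppoint K n -> Prop.

Definition vanishing (f : S) : Prop := forall p, U p -> vanishes_at f p.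
Fact vanishing0 : vanishing 0. Proof. by move=> p _ v _ _; rewrite meval0. Qed.
Fact vanishingD f g : vanishing f -> vanishing g -> vanishing (f + g).
Proof.
by move=> Jf Jg p Up v pv nz_v; rewrite mevalD (Jf p) // (Jg p) // addr0.
Qed.
Fact vanishingM a f : vanishing f -> vanishing (a * f).
Proof. by move=> Jf p Up v pv nz_v; rewrite mevalM (Jf p) // mulr0. Qed.
Fact vanishing_saturated f :
  (forall i : 'I_n.+1, exists k, vanishing ('X_i ^+ k * f)) -> vanishing f.
Proof.
move=> H p Up v pv nz_v; have [i nz_i] : exists i, v ord0 i != 0.
  apply/existsP; apply: contraNT nz_v => /existsPn v0.
  by apply/eqP/rowP => i; rewrite mxE; apply/eqP; rewrite -[_ == _]negbK v0.
have [k /(_ p Up v pv nz_v)/eqP] := H i.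
rewrite mevalM rmorphXn /= mevalXU mulf_eq0 expf_eq0 (negPf nz_i) andbF.
by move/eqP.
Qed.

(** The Zariski closure of U with its reduced structure. *)
Definition zariski_closure : subscheme :=
  forms_scheme vanishing0 vanishingD vanishingM vanishing_saturated.

End Closure.

Definition reduced_points (s : seq (ppoint K n)) : subscheme :=
  zariski_closure (fun p => p \in s).

Definition linear_scheme (V : {vspace 'rV[K]_n.+1}) : subscheme :=
  zariski_closure (fun p => (line_of p <= V)%VS).

(** P lies in the smallest linear subspace containing C as a subscheme. *)
Definition in_span (C : subscheme) (P : ppoint K n) : Prop :=
  forall V : {vspace 'rV[K]_n.+1},
    sub_scheme C (linear_scheme V) -> (line_of P <= V)%VS.

(** The degree e part of the homogeneous coordinate ring of C has dimension
    k. *)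
Definition hilbert_function (C : subscheme) (e k : nat) : Prop :=
  exists2 B : 'I_k -> S, forall i, B i \is e.-homog &
    forall f, f \is e.-homog ->
      exists! c : {ffun 'I_k -> K}, ideal_of C (f - \sum_(i < k) c i *: B i).

(** C is zero-dimensional (or empty, if k = 0) of degree k: its Hilbert
    polynomial is the constant k. *)
Definition has_degree (C : subscheme) (k : nat) : Prop :=
  exists e0, forall e, (e0 <= e)%N -> hilbert_function C e k.

(** Connectedness of the underlying space, tested on its closed points. *)
Definition connected_scheme (C : subscheme) : Prop :=
  (exists p, on_scheme C p) /\
  forall D E : subscheme,
    (forall p, on_scheme C p -> on_scheme D p \/ on_scheme E p) ->
    (forall p, ~ [/\ on_scheme C p, on_scheme D p & on_scheme E p]) ->
    (forall p, on_scheme C p -> on_scheme D p) \/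
    (forall p, on_scheme C p -> on_scheme E p).

(** A proper linear subspace P(V) has dimension \dim V - 1. *)
Definition linearly_general_position (C : subscheme) : Prop :=
  forall V : {vspace 'rV[K]_n.+1}, (\dim V < n.+1)%N ->
    exists2 k, has_degree (inter_scheme C (linear_scheme V)) k &
      (k <= \dim V)%N.

(** Vanishing of the first Cech cohomology group of the ideal sheaf of C
    twisted by d, for the cover of P^n by the open sets x_i != 0.  A section
    over x_i x_j != 0 is a fraction f i j / (x_i x_j)^r with f i j in the ideal
    and homogeneous of degree d + 2r; the cocycle and coboundary equations are
    cleared of denominators. *)
Definition h1_ideal_vanishes (C : subscheme) (d : nat) : Prop :=
  forall (r : nat) (f : 'I_n.+1 -> 'I_n.+1 -> S),
    (forall i j, ideal_of C (f i j) /\ f i j \is (d + r.*2).-homog) ->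
    (forall i j k,
       'X_k ^+ r * f i j - 'X_j ^+ r * f i k + 'X_i ^+ r * f j k = 0) ->
    exists q (g : 'I_n.+1 -> S),
      (forall i, ideal_of C (g i) /\ g i \is (d + (r + q)).-homog) /\
      (forall i j,
         ('X_i * 'X_j) ^+ q * f i j =
         'X_i ^+ (r + q) * g j - 'X_j ^+ (r + q) * g i).

End Subschemes.

Section Veronese.
Variables (K : closedFieldType) (m d : nat).

(** The target is P^N with N = 'C(m + d, m) - 1. *)
Definition veronese_dim : nat := 'C(m + d, m).-1.
Local Notation N := veronese_dim.

Definition degree_monomials : seq 'X_{1..m.+1} :=
  [seq s2m t | t : d.-tuple 'I_m.+1 <- enum (basis m.+1 d)].

Lemma size_degree_monomials : size degree_monomials = N.+1.
Proof.
rewrite size_basis addnC -[in LHS]bin_sub ?leq_addl // addnK.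
by rewrite /veronese_dim prednK // bin_gt0 leq_addr.
Qed.

Lemma mem_degree_monomials a : (a \in degree_monomials) = (mdeg a == d).
Proof. by rewrite -basis_cover. Qed.

Lemma uniq_degree_monomials : uniq degree_monomials.
Proof. exact: uniq_basis. Qed.

Definition veronese_monomial (i : 'I_N.+1) : 'X_{1..m.+1} :=
  nth 0%MM degree_monomials i.

Definition veronese_vector (v : 'rV[K]_m.+1) : 'rV[K]_N.+1 :=
  \row_i ('X_[veronese_monomial i] : {mpoly K[m.+1]}).@[fun j => v ord0 j].

Lemma veronese_vector_neq0 v : v != 0 -> veronese_vector v != 0.
Proof.
move=> nz_v; have [j nz_j] : exists j, v ord0 j != 0.
  apply/existsP; apply: contraNT nz_v => /existsPn v0.
  by apply/eqP/rowP => j; rewrite mxE; apply/eqP; rewrite -[_ == _]negbK v0.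
have mon : (U_(j) *+ d)%MM \in degree_monomials.
  by rewrite mem_degree_monomials mdegMn mdeg1 mul1n.
have lt_i : (index (U_(j) *+ d)%MM degree_monomials < N.+1)%N.
  by rewrite -size_degree_monomials index_mem.
apply: contraNneq nz_j => /rowP/(_ (Ordinal lt_i)).
rewrite !mxE /veronese_monomial nth_index // -mpolyXn rmorphXn /= mevalXU.
by move/eqP; rewrite expf_eq0 => /andP[].
Qed.

Definition veronese (p : ppoint K m) : ppoint K N :=
  ppoint_of (veronese_vector_neq0 (vpick_ppoint_neq0 p)).

Lemma veronese_vectorZ c v :
  veronese_vector (c *: v) = c ^+ d *: veronese_vector v.
Proof.
apply/rowP => i; rewrite !mxE !mevalX.
have /eqP <- : mdeg (veronese_monomial i) == d.
  by rewrite -mem_degree_monomials mem_nth ?size_degree_monomials.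
rewrite mdegE -prodrXr -big_split /=.
by apply: eq_bigr => j _; rewrite mxE exprMn.
Qed.

(** The image of a point does not depend on the chosen representative. *)
Lemma veroneseE v (nz_v : v != 0) :
  line_of (veronese (ppoint_of nz_v)) = <[veronese_vector v]>%VS.
Proof.
have /vlineP[c Ec] : vpick (ppoint_of nz_v) \in <[v]>%VS by apply: memv_pick.
have nz_c : c != 0.
  apply: contraNneq (vpick_ppoint_neq0 (ppoint_of nz_v)) => c0.
  by rewrite Ec c0 scale0r.
rewrite /= Ec veronese_vectorZ; apply/eqP; rewrite eqEsubv -!memvE.
rewrite memvZ ?memv_line //=; apply/vlineP; exists (c ^- d).
by rewrite scalerA mulVf ?scale1r // expf_neq0.
Qed.

Definition veronese_variety (P : ppoint K N) : Prop :=
  exists p, P = veronese p.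

Definition veronese_pullback (g : {mpoly K[N.+1]}) : {mpoly K[m.+1]} :=
  g \mPo [tuple 'X_[veronese_monomial i] | i < N.+1].

Section Image.
Variable C : subscheme K m.

Definition image_ideal (g : {mpoly K[N.+1]}) : Prop :=
  ideal_of C (veronese_pullback g).
Fact image_ideal0 : image_ideal 0.
Proof.
by rewrite /image_ideal /veronese_pullback comp_mpoly0; apply: ideal0.
Qed.
Fact image_idealD f g : image_ideal f -> image_ideal g -> image_ideal (f + g).
Proof.
by rewrite /image_ideal /veronese_pullback comp_mpolyD; apply: idealD.
Qed.
Fact image_idealM a f : image_ideal f -> image_ideal (a * f).
Proof.
by rewrite /image_ideal /veronese_pullback rmorphM; apply: idealM.
Qed.
Fact image_ideal_saturated f :
  (forall i : 'I_N.+1, exists k, image_ideal ('X_i ^+ k * f)) ->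
  image_ideal f.
Proof.
move=> H; apply: ideal_saturated => j.
have mon : (U_(j) *+ d)%MM \in degree_monomials.
  by rewrite mem_degree_monomials mdegMn mdeg1 mul1n.
have lt_i : (index (U_(j) *+ d)%MM degree_monomials < N.+1)%N.
  by rewrite -size_degree_monomials index_mem.
have [k Jk] := H (Ordinal lt_i); exists (d * k)%N; move: Jk.
rewrite /image_ideal /veronese_pullback rmorphM rmorphXn /= comp_mpolyXU.
rewrite -tnth_nth tnth_mktuple /veronese_monomial nth_index // -mpolyXn.
by rewrite exprM.
Qed.

(** The scheme-theoretic image of C: for 0 < d its ideal is the kernel of the
    map from K[y_0..y_N] to the homogeneous coordinate ring of C. *)
Definition veronese_image : subscheme K N :=
  forms_scheme image_ideal0 image_idealD image_idealM image_ideal_saturated.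

End Image.
End Veronese.

Arguments veronese_variety : clear implicits.

Section Rank.
Variables (K : closedFieldType) (n : nat) (X : ppoint K n -> Prop).

Definition spanned_by (P : ppoint K n) (k : nat) : Prop :=
  exists s : seq (ppoint K n),
    [/\ uniq s, size s = k, (forall p, p \in s -> X p) &
        in_span (reduced_points s) P].

Definition secant_variety (k : nat) : subscheme K n :=
  zariski_closure (fun P => spanned_by P k).

Definition least (Q : nat -> Prop) (k : nat) : Prop :=
  Q k /\ forall j, Q j -> (k <= j)%N.

Definition has_rank (P : ppoint K n) : nat -> Prop := least (spanned_by P).

Definition has_border_rank (P : ppoint K n) : nat -> Prop :=
  least (fun k => on_scheme (secant_variety k) P).

End Rank.

(* Main.v *)
Require Import Defs.
From HB Require Import structures.
From Stdlib Require Import ClassicalEpsilon.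
From mathcomp Require Import all_boot all_order all_algebra.
From mathcomp Require Import perm cyclic separable cyclotomic.
From mathcomp Require Import mpoly.
From mathcomp Require Import ring zify.

Set Implicit Arguments.
Unset Strict Implicit.
Unset Printing Implicit Defensive.

Import GRing.Theory.
Local Open Scope ring_scope.

(** Vectors of the ambient space of the Veronese variety are functionals on
    forms of degree d, and the points of the variety are the evaluations at
    points of P^m ([apolar]).  The connected scheme A1 of degree two on L is a
    point o with a tangent direction v along L ([tangent_vector]), so a form
    belongs to the ideal of A when it vanishes at o and at the points p of A2
    and its derivative at o along v vanishes.  The hyperplanes through Z are the
    forms of degree d in that ideal ([in_span_images]).  Hence P is the
    functional f |-> D_v f(o) + sum_p c_p f(p), up to a change of v, with the
    multiple of the value at o removed by Euler's identity; no coefficient is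
    zero because P lies on the span of no smaller scheme.

    Border rank.  The derivative is a limit of difference quotients, so P is a
    limit of sums of t evaluations.  Conversely, general position yields forms
    of degree at least (t - 1) / 2 dual to the t conditions ([dual_forms]),
    products of hyperplanes through pairs of points.  The determinant of the functional
    on the products F_i G_j of such forms, of degrees d %/ 2 and d - d %/ 2,
    vanishes on sums of fewer than t evaluations but not at P.

    Rank.  On binary forms of degree d, the coefficient of T is an average over
    the d-th roots of unity, so D_v is a sum of d evaluations at points of L and
    P has rank at most d + t - 2.  For the lower bound, subtract a decomposition
    of P as a sum of k evaluations: this is a linear relation between D_v, the
    value at o and the values at a finite set W of points, and k < d + t - 2
    means that W has fewer than d + 2 r points, r of them in A2
    ([rank_lower_bound]).  Such a relation is impossible
    ([no_short_tangent_relation]).  The tool is the residual relation: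
    multiplying forms by the equation of a hyperplane lowers the degree by one
    and removes the points of the hyperplane from the relation.  Since a
    relation in degree k involves at least k + 2 points, short relations lie on
    a line, on a plane or on two lines ([relation_line],
    [relation_plane_or_lines]).  Applied to the points of W outside L, this
    leaves, after removing that line, that plane or those two lines, a relation
    which has too few points but still contains a trace of the tangent vector,
    because general position keeps L and the points of A2 apart. *)

(** * Forms with prescribed zeros *)

Local Notation "f .[: v ]" := (f.@[fun i => v ord0 i])
  (at level 2, left associativity, format "f .[: v ]").

Lemma mpoly_ring_ind (R : comNzRingType) n (Q : {mpoly R[n]} -> Prop) :
  (forall c, Q c%:MP) -> (forall i, Q 'X_i) ->
  (forall f g, Q f -> Q g -> Q (f + g)) ->
  (forall f g, Q f -> Q g -> Q (f * g)) -> forall f, Q f.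
Proof.
move=> QC QX QD QM f; rewrite (mpolyE f).
elim/big_ind: _ => [||m _]; [by have := QC 0; rewrite mpolyC0 | exact: QD |].
rewrite -mul_mpolyC; apply: (QM) => //; rewrite mpolyXE_id.
elim/big_ind: _ => [||i _]; [exact: (QC 1) | exact: QM |].
by elim: (m i) => [|k IHk]; [exact: (QC 1) | rewrite exprS; apply: QM].
Qed.

Section Evaluation.
Variables (K : closedFieldType) (n : nat).
Implicit Types (f g : {mpoly K[n.+1]}) (o v x : 'rV[K]_n.+1).

Lemma eval_homogZ e f c v : f \is e.-homog -> f.[: c *: v] = c ^+ e * f.[: v].
Proof.
move=> /dhomogP homf; rewrite !mevalE mulr_sumr [LHS]big_seq [RHS]big_seq.
apply: eq_bigr => m fm; rewrite mulrCA; congr (_ * _).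
have <- : mdeg m = e := homf m fm.
rewrite mdegE -prodrXr -big_split /=.
by apply: eq_bigr => i _; rewrite mxE exprMn.
Qed.

Definition linform (a : 'rV[K]_n.+1) : {mpoly K[n.+1]} :=
  \sum_i a ord0 i *: 'X_i.

Lemma linform_homog a : linform a \is 1.-homog.
Proof. by apply: rpred_sum => i _; rewrite rpredZ // dhomogX /= mdeg1. Qed.

Lemma linformM_homog a f e :
  f \is e.-homog -> linform a * f \is e.+1.-homog.
Proof. by move=> homf; apply: (dhomogM (linform_homog a) homf). Qed.

Lemma eval_linform a v : (linform a).[: v] = \sum_i a ord0 i * v ord0 i.
Proof.
by rewrite raddf_sum; apply: eq_bigr => i _; rewrite /= mevalZ mevalXU.
Qed.

Lemma eval_linformDZ a c v x :
  (linform a).[: v + c *: x] = (linform a).[: v] + c * (linform a).[: x].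
Proof.
rewrite !eval_linform mulr_sumr -big_split; apply: eq_bigr => i _.
by rewrite !mxE mulrDr mulrCA.
Qed.

Lemma linformZ c a : linform (c *: a) = c *: linform a.
Proof.
by rewrite scaler_sumr; apply: eq_bigr => i _; rewrite mxE scalerA.
Qed.

Lemma linformD a b : linform (a + b) = linform a + linform b.
Proof.
by rewrite -big_split; apply: eq_bigr => i _; rewrite mxE scalerDl.
Qed.

(** Some coordinate of the projection along V onto a complement. *)
Lemma separating_linform (V : {vspace 'rV[K]_n.+1}) x : x \notin V ->
  exists a, (forall y, y \in V -> (linform a).[: y] = 0) /\
            (linform a).[: x] != 0.
Proof.
move=> xV; pose w y := y - projv V y.
have /rV0Pn[j nzj] : w x != 0.
  by apply: contraNneq xV => /eqP; rewrite subr_eq0 => /eqP ->; apply: memv_proj.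
pose a : 'rV[K]_n.+1 := \row_i w (delta_mx ord0 i) ord0 j.
have aE (y : 'rV[K]_n.+1) : (linform a).[: y] = w y ord0 j.
  rewrite eval_linform {2}(row_sum_delta y) /w linear_sum /= -sumrB summxE.
  apply: eq_bigr => i _; rewrite linearZ -scalerBr /= [RHS]mxE mulrC.
  by congr (_ * _); rewrite mxE.
exists a; split=> [y yV|]; last by rewrite aE.
by rewrite aE /w projv_id // subrr mxE.
Qed.

(** The linear forms vanishing on V form a vector space over an infinite field,
    which is not covered by finitely many proper subspaces. *)
Lemma avoiding_linform (V : {vspace 'rV[K]_n.+1}) (s : seq 'rV[K]_n.+1) :
  (forall x, x \in s -> x \notin V) ->
  exists a, (forall y, y \in V -> (linform a).[: y] = 0) /\
            forall x, x \in s -> (linform a).[: x] != 0.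
Proof.
elim: s => [|x s IHs] sV.
  exists 0; split=> // y _; rewrite eval_linform big1 // => i _.
  by rewrite mxE mul0r.
have [|a [aV nzs]] := IHs; first by move=> y ys; rewrite sV // inE ys orbT.
have [b [bV bx]] := separating_linform (sV x (mem_head x s)).
pose p := \prod_(y <- s) ((linform a).[: y]%:P + (linform b).[: y] *: 'X).
pose q := (linform a).[: x]%:P + (linform b).[: x] *: 'X.
have nz_lin c0 c1 : (c0 != 0) || (c1 != 0) ->
    (c0%:P + c1 *: 'X : {poly K}) != 0.
  apply: contraTneq => /polyP eq0; have := eq0 0%N; have := eq0 1%N.
  by rewrite !coefE /= mulr1 mulr0 addr0 add0r => -> ->; rewrite eqxx.
have nz_p : p * q != 0.
  rewrite mulf_neq0 ?nz_lin ?bx ?orbT // prodf_seq_neq0; apply/allP => y ys.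
  by rewrite /= nz_lin // nzs.
have [c] := closed_nonrootP _ nz_p; rewrite rootM negb_or => /andP[pc qc].
have cE (y : 'rV[K]_n.+1) : ((linform a).[: y]%:P + (linform b).[: y] *: 'X).[c] =
            (linform (a + c *: b)).[: y].
  by rewrite !hornerE linformD linformZ mevalD mevalZ mulrC.
exists (a + c *: b); split=> [y yV|y].
  by rewrite -cE aV // bV // scale0r addr0 hornerC.
rewrite inE => /predU1P[->|ys]; first by rewrite -cE.
rewrite -cE; apply: contraNneq pc => py0.
by rewrite /root /p horner_prod prodf_seq_eq0; apply/hasP; exists y; rewrite //= py0.
Qed.

(** A hyperplane through each subspace, and further hyperplanes to raise the
    degree. *)
Lemma avoiding_form (Vs : seq {vspace 'rV[K]_n.+1}) (s : seq 'rV[K]_n.+1) e :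
  (size Vs <= e)%N -> (forall x, x \in s -> x != 0) ->
  (forall V x, V \in Vs -> x \in s -> x \notin V) ->
  exists f, [/\ f \is e.-homog,
                forall V y, V \in Vs -> y \in V -> f.[: y] = 0
              & forall x, x \in s -> f.[: x] != 0].
Proof.
move=> + s0; elim: e Vs => [|e IHe] [|V Vs] //= leVs VsP.
- by exists 1; split=> [|//|x _]; rewrite ?dhomog1 ?meval1 ?oner_neq0.
- have [f [homf fV fs]] := IHe [::] isT (fun _ _ => ltac:(done)).
  have [x /s0|a [_ nzs]] := @avoiding_linform 0%VS s; first by rewrite memv0.
  exists (linform a * f); split=> // [|x xs]; first exact: linformM_homog.
  by rewrite mevalM mulf_neq0 ?nzs ?fs.
- have [|f [homf fV fs]] := IHe Vs leVs.
    by move=> W x WVs; apply: VsP; rewrite inE WVs orbT.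
  have [x xs|a [aV nzs]] := @avoiding_linform V s.
    by apply: VsP; rewrite ?mem_head.
  exists (linform a * f); split=> [|W y|x xs].
  + exact: linformM_homog.
  + rewrite inE => /predU1P[->|WVs] yW; rewrite mevalM; first by rewrite aV ?mul0r.
    by rewrite (fV W) ?mulr0.
  + by rewrite mevalM mulf_neq0 ?nzs ?fs.
Qed.

Lemma poly0_of_nonzero_roots (p : {poly K}) :
  (forall c, c != 0 -> p.[c] = 0) -> p = 0.
Proof.
move=> p0; apply/eqP; apply: contraT => nz_p.
have /closed_nonrootP[x] : p * 'X != 0 by rewrite mulf_neq0 ?polyX_eq0.
rewrite rootM negb_or /root hornerX => /andP[px nz_x].
by rewrite p0 ?eqxx in px.
Qed.

End Evaluation.

(** * Restricting forms to a line *)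

Lemma horner_mmap (K : closedFieldType) k (h : 'I_k -> {poly K}) f c :
  (mmap (@polyC K) h f).[c] = f.@[fun i => (h i).[c]].
Proof.
rewrite /mmap horner_sum mevalE; apply: eq_bigr => m _.
by rewrite hornerM hornerC horner_prod; under [in LHS]eq_bigr do rewrite horner_exp.
Qed.

Section Line.
Variables (K : closedFieldType) (n : nat).
Implicit Types (f g : {mpoly K[n.+1]}) (o v x : 'rV[K]_n.+1).

(** The polynomial f(o + T v) in T. *)
Definition along o v : {mpoly K[n.+1]} -> {poly K} :=
  mmap (@polyC K) (fun i => (o ord0 i)%:P + v ord0 i *: 'X).

HB.instance Definition _ o v := GRing.RMorphism.copy (along o v)
  (mmap (@polyC K) (fun i => (o ord0 i)%:P + v ord0 i *: 'X)).

Lemma alongZ o v c f : along o v (c *: f) = c *: along o v f.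
Proof. by rewrite /along mmapZ mul_polyC. Qed.

Lemma horner_along o v f c : (along o v f).[c] = f.[: o + c *: v].
Proof.
rewrite horner_mmap; apply: meval_eq => i.
by rewrite !hornerE !mxE mulrC.
Qed.

Lemma along0E o v f : (along o v f)`_0 = f.[: o].
Proof. by rewrite -horner_coef0 horner_along scale0r addr0. Qed.

Lemma along_linform o v a :
  along o v (linform a) = (linform a).[: o]%:P + (linform a).[: v] *: 'X.
Proof.
rewrite !eval_linform raddf_sum rmorph_sum scaler_suml -big_split.
apply: eq_bigr => i _; rewrite /= alongZ /along mmapX mmap1U.
by rewrite scalerDr scalerA -mul_polyC -polyCM.
Qed.

Lemma size_along o v e f : f \is e.-homog -> (size (along o v f) <= e.+1)%N.
Proof.
move=> /dhomogP homf; rewrite /along /mmap big_seq.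
apply: (leq_trans (size_sum _ _ _)); apply/bigmax_leqP_seq => m mf _.
have <- : mdeg m = e := homf m mf.
rewrite mul_polyC (leq_trans (size_scale_leq _ _)) //.
have sz (p : {poly K}) k : (size p <= 2)%N -> (size (p ^+ k) <= k.+1)%N.
  by move=> sp; rewrite (leq_trans (size_poly_exp_leq _ _)) // ltnS; nia.
rewrite /mmap1 mdegE; elim/big_ind2: _ => [|p a q b pa qb|i _].
- by rewrite size_polyC oner_neq0.
- by rewrite (leq_trans (size_polyMleq _ _)) //; lia.
- apply: sz; rewrite (leq_trans (size_polyD _ _)) // geq_max.
  rewrite (leq_trans (size_polyC_leq1 _)) //=.
  by rewrite (leq_trans (size_scale_leq _ _)) // size_polyX.
Qed.

(** The value at v is the value at infinity on the line. *)
Lemma along_coef_top o v e f : f \is e.-homog -> (along o v f)`_e = f.[: v].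
Proof.
move=> homf; pose c := along o v f.
pose p := along v o f - \sum_(j < e.+1) c`_j *: 'X^(e - j).
have p0 : p = 0.
  apply: poly0_of_nonzero_roots => x nzx.
  rewrite /p !hornerE horner_along horner_sum.
  have -> : v + x *: o = x *: (o + x^-1 *: v).
    by rewrite scalerDr scalerA mulfV // scale1r addrC.
  rewrite (eval_homogZ _ _ homf) -horner_along.
  rewrite (horner_coef_wide _ (size_along o v homf)) mulr_sumr -sumrB big1 // => j _.
  rewrite hornerZ hornerXn -/c mulrCA exprVn.
  by rewrite -expfB_cond ?subrr // (negPf nzx) add0n -ltnS ltn_ord.
have := congr1 (fun q : {poly K} => q`_0) p0.
rewrite /p coefB along0E coef0 => /eqP; rewrite subr_eq0 => /eqP ->.
rewrite [RHS]coef_sum [RHS]big_ord_recr /= subnn [X in _ + X]coefZ coefXn eqxx mulr1.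
rewrite big1 ?add0r //.
by move=> j _; rewrite coefZ coefXn eq_sym subn_eq0 leqNgt ltn_ord mulr0.
Qed.

Lemma along_eq0 o v e f a b :
  f \is e.-homog -> along o v f = 0 -> f.[: a *: o + b *: v] = 0.
Proof.
move=> homf f0; have [->|nza] := eqVneq a 0.
  by rewrite scale0r add0r (eval_homogZ _ _ homf) -(along_coef_top o v homf) f0
             coef0 mulr0.
have -> : a *: o + b *: v = a *: (o + (b / a) *: v).
  by rewrite scalerDr scalerA mulrC divfK.
by rewrite (eval_homogZ _ _ homf) -horner_along f0 horner0 mulr0.
Qed.

Lemma dual_linforms o v : o != 0 -> v \notin <[o]>%VS ->
  exists a b, [/\ (linform a).[: o] = 1, (linform a).[: v] = 0,
                  (linform b).[: o] = 0 & (linform b).[: v] = 1].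
Proof.
move=> nzo vo.
have ov : o \notin <[v]>%VS.
  apply: contra vo => /vlineP[c Ec]; apply/vlineP; exists c^-1.
  have nzc : c != 0 by apply: contraNneq nzo => c0; rewrite Ec c0 scale0r.
  by rewrite Ec scalerA mulVf ?scale1r.
have [a [av ao]] := separating_linform ov.
have [b [bo bv]] := separating_linform vo.
exists ((linform a).[: o]^-1 *: a), ((linform b).[: v]^-1 *: b).
by rewrite !linformZ !mevalZ (av v) ?(bo o) ?memv_line // !mulr0 !mulVf.
Qed.

(** The homogenization of p in degree e, written in the coordinates a and b of
    a line. *)
Definition binform (a b : 'rV[K]_n.+1) e (p : {poly K}) : {mpoly K[n.+1]} :=
  \sum_(j < e.+1) p`_j *: (linform a ^+ (e - j) * linform b ^+ j).

Lemma linform_exp_homog a e : linform a ^+ e \is [in K[n.+1], e.-homog].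
Proof. by have := dhomogMn e (linform_homog a); rewrite mul1n. Qed.

Lemma binform_homog a b e p : binform a b e p \is e.-homog.
Proof.
apply: rpred_sum => j _; apply: rpredZ.
have := dhomogM (linform_exp_homog a (e - j)) (linform_exp_homog b j).
by rewrite subnK // -ltnS.
Qed.

Lemma along_binform o v a b e (p : {poly K}) :
  (linform a).[: o] = 1 -> (linform a).[: v] = 0 ->
  (linform b).[: o] = 0 -> (linform b).[: v] = 1 -> (size p <= e.+1)%N ->
  along o v (binform a b e p) = p.
Proof.
move=> ao av bo bv szp; rewrite -[RHS](coefK p) poly_def rmorph_sum /=.
rewrite (big_ord_widen _ (fun i => p`_i *: 'X^i) szp) [RHS]big_mkcond /=.
apply: eq_bigr => j _; rewrite alongZ rmorphM !rmorphXn /= !along_linform.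
rewrite ao av bo bv scale0r addr0 add0r scale1r expr1n mul1r.
by case: ltnP => // lej; rewrite nth_default ?scale0r.
Qed.

End Line.

(** * Ideals and points of subschemes *)

Lemma skolem (A B : Type) (R : A -> B -> Prop) :
  (forall a, exists b, R a b) -> exists F, forall a, R a (F a).
Proof.
move=> ex; exists (fun a => proj1_sig (constructive_indefinite_description _ (ex a))).
by move=> a; case: constructive_indefinite_description.
Qed.

Section Ideals.
Variables (K : closedFieldType) (n : nat).
Implicit Types (f g : {mpoly K[n.+1]}) (C : subscheme K n) (p q : ppoint K n).

Lemma idealZ C c f : ideal_of C f -> ideal_of C (c *: f).
Proof. by rewrite -mul_mpolyC; apply: idealM. Qed.

Lemma idealN C f : ideal_of C f -> ideal_of C (- f).
Proof. by rewrite -scaleN1r; apply: idealZ. Qed.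

Lemma idealB C f g : ideal_of C f -> ideal_of C g -> ideal_of C (f - g).
Proof. by move=> If Ig; apply: idealD => //; apply: idealN. Qed.

Lemma ideal_sum C (I : Type) (r : seq I) (P : pred I) F :
  (forall i, P i -> ideal_of C (F i)) -> ideal_of C (\sum_(i <- r | P i) F i).
Proof.
by move=> IF; elim/big_ind: _ => //; [exact: ideal0 | exact: idealD].
Qed.

Lemma vpick_neq0 p : vpick p != 0.
Proof. exact: vpick_ppoint_neq0. Qed.

Lemma ppoint_vline p : line_of p = <[vpick p]>%VS.
Proof.
apply/esym/eqP; rewrite eqEdim dim_ppoint dim_vline vpick_neq0 leqnn andbT.
by rewrite -memvE memv_pick.
Qed.

Lemma ppoint_le p (V : {vspace 'rV[K]_n.+1}) :
  (line_of p <= V)%VS = (vpick p \in V).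
Proof. by rewrite {1}ppoint_vline -memvE. Qed.

Lemma ppoint_eq_mem p q : (vpick p \in line_of q) = (p == q).
Proof.
apply/idP/eqP => [pq|->]; last exact: memv_pick.
apply/val_inj/eqP; rewrite /= eqEdim !dim_ppoint leqnn andbT.
by rewrite ppoint_le.
Qed.

Lemma ppointP p v : v \in line_of p -> v != 0 ->
  exists2 c, c != 0 & vpick p = c *: v.
Proof.
rewrite {1}ppoint_vline => /vlineP[c ->]; rewrite scaler_eq0 negb_or => /andP[nzc _].
by exists c^-1; rewrite ?invr_eq0 // scalerA mulVf // scale1r.
Qed.

Lemma vpick_ppoint_of v (nzv : v != 0) :
  exists2 c, c != 0 & vpick (ppoint_of nzv : ppoint K n) = c *: v.
Proof. by apply: ppointP => //; apply: memv_line. Qed.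

Lemma vanishes_homog e f p : f \is e.-homog ->
  vanishes_at f p <-> f.[: vpick p] = 0.
Proof.
move=> homf; split=> [/(_ _ (memv_pick p) (vpick_neq0 p)) //|f0 v pv nzv].
have [c nzc Ep] := ppointP pv nzv.
move/eqP: f0; rewrite Ep (eval_homogZ _ _ homf) mulf_eq0 expf_eq0 (negPf nzc).
by rewrite andbF => /eqP.
Qed.

Lemma homog_component f e e' : f \is e.-homog ->
  pihomog mdeg e' f = if e == e' then f else 0.
Proof.
move=> homf; case: eqVneq => [<-|ne]; first exact: pihomog_dE.
exact: pihomog_ne0 ne homf.
Qed.

Lemma ideal_components C f :
  (forall e, ideal_of C (pihomog mdeg e f)) -> ideal_of C f.
Proof.
move=> If; rewrite (pihomog_partitionE (leqnn (mmeasure mdeg f))).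
by apply: ideal_sum => e _.
Qed.

Lemma on_schemeP C p :
  (forall e f, f \is e.-homog -> ideal_of C f -> f.[: vpick p] = 0) ->
  on_scheme C p.
Proof.
move=> C0 f If v pv nzv.
rewrite (pihomog_partitionE (leqnn (mmeasure mdeg f))) raddf_sum big1 //= => e _.
have homfe := pihomogP mdeg e f.
apply: (iffRL (vanishes_homog p homfe)) => //.
by apply: C0 homfe _; apply: ideal_homog.
Qed.

Lemma on_scheme_eval C p f : on_scheme C p -> ideal_of C f -> f.[: vpick p] = 0.
Proof. by move=> Cp /Cp; apply; [exact: memv_pick | exact: vpick_neq0]. Qed.

Lemma ideal_forms (J : {mpoly K[n.+1]} -> Prop) f e : J 0 ->
  f \is e.-homog -> forms_ideal J f <-> J f.
Proof.
move=> J0 homf; split=> [/(_ e)|Jf e']; rewrite (homog_component _ homf) ?eqxx //.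
by case: ifP.
Qed.

Lemma ideal_closure (U : ppoint K n -> Prop) e f : f \is e.-homog ->
  ideal_of (zariski_closure U) f <-> forall p, U p -> f.[: vpick p] = 0.
Proof.
move=> homf; split.
  move/(ideal_forms (@vanishing0 _ _ U) homf) => Uf p /Uf.
  by move/(vanishes_homog p homf).
move=> Uf; apply/(ideal_forms (@vanishing0 _ _ U) homf) => p Up.
by apply/(vanishes_homog p homf)/Uf.
Qed.

Lemma ideal_linear (V : {vspace 'rV[K]_n.+1}) e f : f \is e.-homog ->
  (0 < e)%N ->
  ideal_of (linear_scheme V) f <-> forall v, v \in V -> f.[: v] = 0.
Proof.
move=> homf e_gt0; rewrite (ideal_closure _ homf).
split=> f0 => [v vV|p]; last by rewrite ppoint_le; apply: f0.
have [->|nzv] := eqVneq v 0.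
  have -> : 0 = 0 *: (0 : 'rV[K]_n.+1) by rewrite scale0r.
  by rewrite (eval_homogZ _ _ homf) expr0n gtn_eqF // mul0r.
have [|c nzc Ec] := ppointP (p := ppoint_of nzv) _ nzv; first exact: memv_line.
have := f0 (ppoint_of nzv); rewrite -memvE vV => /(_ isT)/eqP.
by rewrite Ec (eval_homogZ _ _ homf) mulf_eq0 expf_eq0 (negPf nzc) andbF => /eqP.
Qed.

Lemma sub_linear_point C V p :
  sub_scheme C (linear_scheme V) -> on_scheme C p -> (line_of p <= V)%VS.
Proof.
move=> CV Cp; rewrite ppoint_le; apply/negPn/negP => pV.
have [a [aV ap]] := separating_linform pV; case/negP: ap; apply/eqP.
apply: (on_scheme_eval Cp); apply: CV.
by apply/(ideal_linear _ (linform_homog a)).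
Qed.

Lemma separating_forms (s : seq (ppoint K n)) e : uniq s -> (size s <= e)%N ->
  exists F : ppoint K n -> {mpoly K[n.+1]}, forall p, p \in s ->
    F p \is e.-homog /\ forall q, q \in s -> (F p).[: vpick q] = (q == p)%:R.
Proof.
move=> us les.
have sep p : exists f, p \in s -> f \is e.-homog /\
    forall q, q \in s -> f.[: vpick q] = (q == p)%:R.
  have [ps|_] := boolP (p \in s); last by exists 0.
  pose Vs := [seq line_of q | q <- s & q != p].
  have [||V x|f [homf fV fp]] := @avoiding_form _ _ Vs [:: vpick p] e.
  - by rewrite size_map size_filter (leq_trans (count_size _ _)).
  - by move=> x; rewrite inE => /eqP->; apply: vpick_neq0.
  - case/mapP => q; rewrite mem_filter => /andP[qp _] ->; rewrite inE => /eqP->.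
    by rewrite ppoint_eq_mem eq_sym.
  have nzf := fp _ (mem_head _ _).
  exists ((f.[: vpick p])^-1 *: f) => _; split=> [|q qs]; first exact: rpredZ.
  rewrite mevalZ; case: eqVneq => [->|qp]; first by rewrite mulVf.
  by rewrite (fV (line_of q) (vpick q)) ?mulr0 ?memv_pick ?map_f // mem_filter qp.
by have [F FP] := skolem sep; exists F.
Qed.

End Ideals.

(** * Subschemes of finite degree *)

Section Degree.
Variables (K : closedFieldType) (n : nat).
Implicit Types (f g : {mpoly K[n.+1]}) (C : subscheme K n) (p q : ppoint K n).

(** The forms of degree e modulo the ideal have dimension k. *)
Lemma dependent_mod_ideal C e k N (F : 'I_N -> {mpoly K[n.+1]}) :
  hilbert_function C e k -> (k < N)%N -> (forall i, F i \is e.-homog) ->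
  exists2 x : 'rV[K]_N, x != 0 & ideal_of C (\sum_i x ord0 i *: F i).
Proof.
case=> B homB genB lt_kN homF.
have /fin_all_exists[c cP] i : exists c : {ffun 'I_k -> K},
    ideal_of C (F i - \sum_(j < k) c j *: B j).
  by have [c [? _]] := genB (F i) (homF i); exists c.
pose M : 'M[K]_(N, k) := \matrix_(i, j) c i j.
have nz_ker : kermx M != 0.
  by rewrite -mxrank_eq0 mxrank_ker -lt0n subn_gt0 (leq_ltn_trans (rank_leq_col M)).
exists (nz_row (kermx M)); first by rewrite nz_row_eq0.
set x := nz_row _; have xM : x *m M = 0 by apply/sub_kermxP/nz_row_sub.
have -> : \sum_i x ord0 i *: F i =
          \sum_i x ord0 i *: (F i - \sum_(j < k) c i j *: B j).
  transitivity (\sum_i x ord0 i *: F i - \sum_(j < k) (x *m M) ord0 j *: B j).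
    by rewrite xM [X in _ - X]big1 ?subr0 // => j _; rewrite mxE scale0r.
  under [RHS]eq_bigr do rewrite scalerBr; rewrite sumrB; congr (_ - _).
  under eq_bigr do rewrite mxE scaler_suml.
  rewrite exchange_big; apply: eq_bigr => i _; rewrite scaler_sumr.
  by apply: eq_bigr => j _; rewrite mxE scalerA.
by apply: ideal_sum => i _; apply: idealZ.
Qed.

(** Distinct points impose independent conditions on forms of large degree. *)
Lemma points_le_degree C k (s : seq (ppoint K n)) :
  has_degree C k -> uniq s -> (forall p, p \in s -> on_scheme C p) ->
  (size s <= k)%N.
Proof.
case=> e0 hilb us Cs; rewrite leqNgt; apply/negP => lt_ks.
have [F FP] := separating_forms us (leq_maxr e0 (size s)).
pose pt i := tnth (in_tuple s) i.
have pts i : pt i \in s by apply: (mem_tnth i (in_tuple s)).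
have [x nzx Ix] := dependent_mod_ideal (F := F \o pt) (hilb _ (leq_maxl _ _)) lt_ks
  (fun i => (FP _ (pts i)).1).
case/negP: nzx; apply/eqP/rowP => i; rewrite [RHS]mxE.
have := on_scheme_eval (Cs _ (pts i)) Ix.
rewrite raddf_sum (bigD1 i) //= mevalZ (FP _ (pts i)).2 //.
rewrite eqxx mulr1 big1 ?addr0 // => j ji.
rewrite mevalZ (FP _ (pts j)).2 // (inj_eq (tuple_uniqP (in_tuple s) us)).
by rewrite eq_sym (negPf ji) mulr0.
Qed.

Lemma on_reduced_points (s : seq (ppoint K n)) p :
  on_scheme (reduced_points s) p <-> p \in s.
Proof.
split=> [sp|ps]; last first.
  by apply: on_schemeP => e f homf /(ideal_closure _ homf); apply.
apply/negPn/negP => ps.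
have [||V x|f [homf fV fp]] :=
    @avoiding_form _ _ [seq line_of q | q <- s] [:: vpick p] (size s).
- by rewrite size_map.
- by move=> x; rewrite inE => /eqP->; apply: vpick_neq0.
- case/mapP => q qs ->; rewrite inE => /eqP->; rewrite ppoint_eq_mem.
  by apply: contraNneq ps => ->.
have /eqP := fp _ (mem_head _ _); apply; apply: (on_scheme_eval sp).
apply/(ideal_closure _ homf) => q qs; apply: (fV (line_of q)).
  exact: map_f.
exact: memv_pick.
Qed.

(** A third point would exceed the degree, and two points are disconnected. *)
Lemma connected_degree2_point C : connected_scheme C -> has_degree C 2 ->
  exists o, forall p, on_scheme C p <-> p = o.
Proof.
move=> [[o Co] connC] degC; exists o => p; split=> [Cp|->//].
apply/eqP/negPn/negP => po.
have only2 q : on_scheme C q -> q = o \/ q = p.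
  move=> Cq; have [->|qo] := eqVneq q o; first by left.
  have [->|qp] := eqVneq q p; first by right.
  have uqop : uniq [:: q; o; p].
    by rewrite /= !inE (negPf qo) (negPf qp) eq_sym (negPf po).
  suff: (3 <= 2)%N by [].
  apply: (points_le_degree degC uqop) => x.
  by rewrite !inE => /or3P[]/eqP->.
have [q Cq|q [_]|/(_ p Cp)|/(_ o Co)] :=
    connC (reduced_points [:: o]) (reduced_points [:: p]).
- by case: (only2 q Cq) => ->; [left|right]; apply/on_reduced_points/mem_head.
- move/on_reduced_points; rewrite inE => /eqP->.
  by move/on_reduced_points; rewrite inE eq_sym (negPf po).
- by move/on_reduced_points; rewrite inE (negPf po).
- by move/on_reduced_points; rewrite inE eq_sym (negPf po).
Qed.

(** Some power of g multiplies f into the ideal: g is in the radical of the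
    colon ideal of f. *)
Definition power_into C f g := exists N, ideal_of C (g ^+ N * f).

Lemma power_intoD C f g h :
  power_into C f g -> power_into C f h -> power_into C f (g + h).
Proof.
move=> [N gN] [M hM]; exists (N + M)%N; rewrite exprDn mulr_suml.
apply: ideal_sum => i _; rewrite -mulr_natl -!mulrA.
apply: idealM; case: (leqP M i) => [le_Mi|lt_iM].
  apply: idealM; rewrite -(subnK le_Mi) exprD -mulrA; exact: idealM.
rewrite mulrCA; apply: idealM.
have -> : (N + M - i = (M - i) + N)%N by lia.
by rewrite exprD -mulrA; apply: idealM.
Qed.

Lemma power_intoM C f a g : power_into C f g -> power_into C f (a * g).
Proof. by case=> N gN; exists N; rewrite exprMn -mulrA; apply: idealM. Qed.

Lemma power_into_ideal C f g : ideal_of C g -> power_into C f g.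
Proof. by move=> Ig; exists 1%N; rewrite expr1 mulrC; apply: idealM. Qed.

Lemma power_intoX C f g k : power_into C f (g ^+ k) -> power_into C f g.
Proof. by case=> N; rewrite -exprM; exists (k * N)%N. Qed.

Lemma saturated_power_into C f :
  (forall i, power_into C f 'X_i) -> ideal_of C f.
Proof. exact: ideal_saturated. Qed.

End Degree.

(** * Subschemes of a line *)

Section OnLine.
Variables (K : closedFieldType) (n : nat) (C : subscheme K n).
Variables (L : {vspace 'rV[K]_n.+1}) (o v : 'rV[K]_n.+1).
Hypotheses (CL : sub_scheme C (linear_scheme L)) (nzo : o != 0)
  (vo : v \notin <[o]>%VS) (defL : L = (<[o]> + <[v]>)%VS).
Implicit Types f g : {mpoly K[n.+1]}.

Lemma line_ideal e f : f \is e.-homog -> along o v f = 0 -> ideal_of C f.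
Proof.
move=> homf f0; apply: CL; apply/(ideal_closure _ homf) => p.
rewrite ppoint_le defL => /memv_addP[_ /vlineP[a ->] [_ /vlineP[b ->] ->]].
exact: along_eq0 homf f0.
Qed.

(** A subscheme of the line which misses v and whose ideal contains a form
    restricting to T^k contains the k-fold point at o: both coordinates of the
    line, hence all variables, multiply any form vanishing to order k at o
    into the ideal after raising to a power, and the ideal is saturated. *)
Lemma line_ideal_multiple k E G e H f d :
  G \is E.-homog -> ideal_of C G -> along o v G = 'X^k ->
  H \is e.-homog -> ideal_of C H -> H.[: v] != 0 ->
  f \is d.-homog -> 'X^k %| along o v f -> ideal_of C f.
Proof.
move=> homG IG GE homH IH Hv homf dvdf.
have [a [b [ao av bo bv]]] := dual_linforms nzo vo.
have aR g e' : g \is e'.-homog ->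
    ideal_of C (g - binform a b e' (along o v g)).
  move=> homg; apply: (line_ideal (e := e')).
    by rewrite rpredB // binform_homog.
  by rewrite rmorphB /= along_binform ?subrr // (size_along o v homg).
have Qa : power_into C f (linform a).
  pose r := along o v f %/ 'X^k; pose M := (d + size r)%N.
  exists (E + M - d)%N.
  have le_dEM : (d <= E + M)%N by rewrite /M; lia.
  rewrite -[_ * f]subr0 -[0](subrr (G * binform a b M r)) opprB addrA.
  rewrite addrAC; apply: idealD; last by rewrite mulrC; apply: idealM.
  apply: (line_ideal (e := (E + M)%N)).
    apply: rpredB; last by apply: dhomogM homG (binform_homog _ _ _ _).
    have := dhomogM (linform_exp_homog a (E + M - d)) homf.
    by rewrite subnK.
  rewrite rmorphB !rmorphM rmorphXn /= along_binform //; last first.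
    by rewrite /M (leq_trans (leq_addl d _)).
  by rewrite along_linform ao av scale0r addr0 expr1n mul1r GE mulrC divpK // subrr.
have Qb : power_into C f (linform b).
  apply: (@power_intoX _ _ _ _ _ e).
  have -> : linform b ^+ e = H.[: v]^-1%:MP * (H.[: v] *: linform b ^+ e).
    by rewrite mul_mpolyC scalerA mulVf ?scale1r.
  apply: power_intoM; have := aR _ _ homH; rewrite /binform big_ord_recr /=.
  rewrite subnn expr0 mul1r (along_coef_top _ _ homH); set S := \sum_(_ < _) _.
  move=> IHS; have -> : H.[: v] *: linform b ^+ e =
      H + -1 * (H - (S + H.[: v] *: linform b ^+ e)) + -1 * S.
    by set X := _ *: _; ring.
  apply: power_intoD; first apply: power_intoD.
  - exact: power_into_ideal.
  - by apply: power_intoM; apply: power_into_ideal.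
  - apply: power_intoM; rewrite /S.
    elim/big_ind: _ => [||j _]; first exact/power_into_ideal/ideal0.
      exact: power_intoD.
    rewrite -mul_mpolyC mulrCA mulrC; have -> : (e - j = (e - j).-1.+1)%N.
      by rewrite prednK // subn_gt0.
    by rewrite exprSr mulrA; apply: power_intoM.
apply: saturated_power_into => i.
have hom1 : ('X_i : {mpoly K[n.+1]}) \is 1.-homog by rewrite dhomogX /= mdeg1.
pose l : {mpoly K[n.+1]} := o ord0 i *: linform a + v ord0 i *: linform b.
have -> : 'X_i = ('X_i - l) + l by rewrite subrK.
apply: power_intoD.
  apply: power_into_ideal; apply: (line_ideal (e := 1%N)).
    by rewrite rpredB // rpredD // rpredZ ?linform_homog.
  rewrite rmorphB rmorphD /= !alongZ !along_linform ao av bo bv.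
  rewrite /along mmapX mmap1U polyC0 scale0r addr0 add0r scale1r.
  by rewrite polyC1 alg_polyC subrr.
by apply: power_intoD; rewrite -mul_mpolyC; apply: power_intoM.
Qed.

End OnLine.

Section TangentVector.
Variable K : closedFieldType.

Lemma ex_least (Q : nat -> Prop) : (exists k, Q k) -> exists k, least Q k.
Proof.
case=> k; have [m] := ubnP k; elim: m k => // m IHm k lt_km Qk.
have [[j [lt_jk Qj]]|none] := classic (exists j, (j < k)%N /\ Q j).
  by apply: IHm Qj; lia.
exists k; split=> // j Qj; rewrite leqNgt; apply/negP => lt_jk.
by apply: none; exists j.
Qed.

Lemma zero_roots_monomial (g : {poly K}) : g != 0 ->
  (forall z, root g z -> z = 0) -> exists2 c, c != 0 & g = c *: 'X^((size g).-1).
Proof.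
move=> nzg g0; have [r Dg] := closed_field_poly_normal g.
have nzc : lead_coef g != 0 by rewrite lead_coef_eq0.
exists (lead_coef g) => //.
have -> : (size g).-1 = size r by rewrite {1}Dg size_scale // size_prod_XsubC.
rewrite {1}Dg; congr (_ *: _).
have r0 z : z \in r -> z = 0.
  by move=> zr; apply: g0; rewrite Dg rootZ // root_prod_XsubC.
rewrite big_seq (eq_bigr (fun=> 'X)) => [|z /r0 ->]; last by rewrite subr0.
by rewrite -big_seq big_const_seq count_predT iter_mulr_1.
Qed.

(** The forms vanishing at a point have codimension at most one. *)
Lemma degree2_not_point n (C : subscheme K n) (o : 'rV[K]_n.+1) e :
  hilbert_function C e 2 ->
  (forall f, f \is e.-homog -> f.[: o] = 0 -> ideal_of C f) -> False.
Proof.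
move=> [B homB genB] Io; have [c0 [_ uniq_c]] := genB 0 (rpred0 _).
have eq0 (c : {ffun 'I_2 -> K}) : \sum_(i < 2) c i * (B i).[: o] = 0 -> c = [ffun=> 0].
  move=> Bo; transitivity c0; first symmetry; apply: uniq_c.
    rewrite sub0r; apply: idealN; apply: Io.
      by apply: rpred_sum => i _; apply: rpredZ; apply: homB.
    by rewrite raddf_sum -[RHS]Bo; apply: eq_bigr => i _; rewrite /= mevalZ.
  rewrite big1 ?subr0; first exact: ideal0.
  by move=> i _; rewrite ffunE scale0r.
pose b i := (B i).[: o].
have /ffunP Eb : [ffun i : 'I_2 => if i == ord0 then b ord_max else - b ord0] =
          [ffun=> 0].
  apply: eq0; rewrite !big_ord_recl big_ord0 !ffunE /= /b.
  by rewrite (_ : lift ord0 ord0 = ord_max); [ring | apply: val_inj].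
have b1 : b ord_max = 0 by have := Eb ord0; rewrite !ffunE.
have b0 : b ord0 = 0.
  by have := Eb ord_max; rewrite !ffunE /= => /eqP; rewrite oppr_eq0 => /eqP.
have /ffunP/(_ ord0) : [ffun=> 1] = [ffun=> 0] :> {ffun 'I_2 -> K}.
  apply: eq0; rewrite !big_ord_recl big_ord0 !ffunE -/(b _) b0.
  rewrite (_ : lift ord0 ord0 = ord_max) -/(b _); last exact: val_inj.
  by rewrite b1 !mulr0 !addr0.
by rewrite !ffunE => /eqP; rewrite oner_eq0.
Qed.

Variables (n : nat) (C : subscheme K n) (L : {vspace 'rV[K]_n.+1}).
Hypotheses (CL : sub_scheme C (linear_scheme L)) (dimL : \dim L = 2%N)
  (connC : connected_scheme C) (degC : has_degree C 2).
Implicit Types f g : {mpoly K[n.+1]}.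

(** The restrictions to the line of the forms in the ideal make up an ideal of
    K[T].  The roots of its generator are points of the scheme, so that it is a
    power of T; among 1, T, T^2 there is a relation modulo the ideal, so that
    the power is at most two, and the scheme is more than a point. *)
Lemma tangent_vector : exists (o : ppoint K n) (v : 'rV[K]_n.+1),
  [/\ L = (<[vpick o]> + <[v]>)%VS, v \notin <[vpick o]>%VS
    & forall e f, f \is e.-homog ->
        ideal_of C f <-> 'X^2 %| along (vpick o) v f].
Proof.
have [o Co] := connected_degree2_point connC degC.
have oC : on_scheme C o by apply/Co.
have oL : vpick o \in L by rewrite -ppoint_le (sub_linear_point CL).
have [v vL vo] : exists2 v, v \in L & v \notin <[vpick o]>%VS.
  apply/subvPn; apply/negP => /dimvS; rewrite dimL dim_vline vpick_neq0.
  by [].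
have defL : L = (<[vpick o]> + <[v]>)%VS.
  apply/esym/eqP; rewrite eqEdim subv_add -!memvE oL vL dimL /=.
  have cap0 : (<[vpick o]> :&: <[v]>)%VS = 0%VS.
    apply/eqP; rewrite -subv0; apply/subvP => x /memv_capP[xo /vlineP[c Ex]].
    rewrite memv0 Ex; have [->|nzc] := eqVneq c 0; first by rewrite scale0r.
    by move: xo; rewrite Ex rpredZeq (negPf nzc) (negPf vo).
  rewrite dimv_disjoint_sum // !dim_vline vpick_neq0.
  by rewrite (contraNneq _ vo) // => ->; apply: mem0v.
exists o, v; split=> //.
have nzo := vpick_neq0 o.
have [a [b [ao av bo bv]]] := dual_linforms nzo vo.
(* The point v at infinity is not on the scheme. *)
have [eH [H [homH IH Hv]]] :
    exists e H, [/\ H \is e.-homog, ideal_of C H & H.[: v] != 0].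
  apply: NNPP => noH; have nzv : v != 0 by apply: contraNneq vo => ->; apply: mem0v.
  have : ppoint_of nzv = o.
    apply/Co/on_schemeP => e f homf If; have [c _ ->] := vpick_ppoint_of nzv.
    rewrite (eval_homogZ _ _ homf); apply/eqP/contraT => nz.
    case: noH; exists e, f; split=> //; apply: contraNneq nz => ->.
    by rewrite mulr0.
  by move=> Ep; case/negP: vo; rewrite -ppoint_vline -Ep memv_line.
(* The ideal of K[T] cut out on the affine part of the line. *)
pose J p := exists e f, [/\ f \is e.-homog, ideal_of C f & along (vpick o) v f = p].
have JM p r : J p -> J (p * r).
  move=> [e [f [homf If <-]]]; exists (e + size r)%N.
  exists (f * binform a b (size r) r); split.
  - exact: dhomogM homf (binform_homog _ _ _ _).
  - by rewrite mulrC; apply: idealM.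
  - by rewrite rmorphM /= along_binform.
have along_a e : along (vpick o) v (linform a ^+ e) = 1.
  by rewrite rmorphXn /= along_linform ao av scale0r addr0 expr1n.
have JB p r : J p -> J r -> J (p - r).
  move=> [e [f [homf If <-]]] [e' [g [homg Ig <-]]]; exists (e + e')%N.
  exists (f * linform a ^+ e' - linform a ^+ e * g); split.
  - by rewrite rpredB // dhomogM ?linform_exp_homog.
  - by apply: idealB; [rewrite mulrC|]; apply: idealM.
  - by rewrite rmorphB !rmorphM /= !along_a mulr1 mul1r.
have [e0 hilbC] := degC.
have [g2 [nzg2 Jg2 szg2]] : exists p : {poly K}, [/\ p != 0, J p & (size p <= 3)%N].
  pose e := maxn e0 2; have homF (i : 'I_3) := binform_homog a b e 'X^i.
  have [x nzx Ix] := dependent_mod_ideal (hilbC _ (leq_maxl e0 2)) (isT : (2 < 3)%N) homF.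
  exists (\poly_(i < 3) x ord0 (inord i)); split; last exact: size_poly.
    apply: contraNneq nzx => /polyP p0; apply/eqP/rowP => i; rewrite mxE.
    by have := p0 i; rewrite coef_poly ltn_ord coef0 inord_val.
  exists e, (\sum_(i < 3) x ord0 i *: binform a b e 'X^i); split=> //; last first.
  - rewrite rmorph_sum poly_def /=; apply: eq_bigr => i _.
    rewrite alongZ along_binform ?inord_val // size_polyXn.
    by rewrite (leq_trans (ltn_ord i)) // ltnS leq_maxr.
  - by apply: rpred_sum => i _; apply: rpredZ; apply: homF.
have [k [[g [nzg Jg szg]] min_g]] :=
  ex_least (ex_intro (fun k => exists p : {poly K}, [/\ p != 0, J p & size p = k]) _
              (ex_intro _ g2 (And3 nzg2 Jg2 erefl))).
have szg3 : (size g <= 3)%N.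
  by rewrite szg (leq_trans _ szg2) // min_g //; exists g2.
have dvd_g p : J p -> g %| p.
  move=> Jp; apply/modp_eq0P/eqP; apply: contraT => nzr.
  have : (k <= size (p %% g)%R)%N.
    apply: min_g; exists (p %% g); split=> //.
    have -> : p %% g = p - g * (p %/ g).
      by rewrite {2}(divp_eq p g) mulrC addrC addKr.
    by apply: JB => //; apply: JM.
  by rewrite -szg leqNgt ltn_modp nzg.
have v_coef z : z *: v \in <[vpick o]>%VS -> z = 0.
  by rewrite rpredZeq (negPf vo) orbF => /eqP.
have root_g z : root g z -> z = 0.
  move=> gz; apply: v_coef.
  have [z0|nzp] := eqVneq (vpick o + z *: v) 0.
    have /eqP -> : z *: v == - vpick o by rewrite -addr_eq0 addrC z0.
    by rewrite memvN memv_line.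
  have Eo : ppoint_of nzp = o.
    apply/Co/on_schemeP => e f homf If; have [c _ ->] := vpick_ppoint_of nzp.
    rewrite (eval_homogZ _ _ homf) -horner_along.
    have /divpK <- : g %| along (vpick o) v f by apply: dvd_g; exists e, f.
    by rewrite hornerM (rootP gz) !mulr0.
  rewrite -[z *: v](addKr (vpick o)) memvD ?memvN ?memv_line //.
  by rewrite -ppoint_vline -{2}Eo memv_line.
have [c nzc Dg] := zero_roots_monomial nzg root_g.
set j := (size g).-1 in Dg.
have lt_j3 : (j < 3)%N by rewrite /j prednK // lt0n size_poly_eq0.
have g0 : g.[0] = 0.
  have [e [f [homf If <-]]] := Jg.
  by rewrite horner_along scale0r addr0; apply: on_scheme_eval If.
have j_gt0 : (0 < j)%N.
  rewrite lt0n; apply: contraNneq nzc => j0.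
  by move/eqP: g0; rewrite Dg j0 expr0 hornerZ hornerC mulr1.
have [eG [G [homG IG GE]]] : J 'X^j.
  have := JM _ c^-1%:P Jg; rewrite mulrC mul_polyC {1}Dg scalerA mulVf //.
  by rewrite scale1r.
have in_ideal e f : f \is e.-homog -> 'X^j %| along (vpick o) v f -> ideal_of C f.
  exact: (line_ideal_multiple CL nzo vo defL homG IG GE homH IH Hv).
have Ej : j = 2%N.
  have [j1|] : j = 1%N \/ j = 2%N by lia.
    have [] := @degree2_not_point n C (vpick o) e0 (hilbC _ (leqnn _)) => f homf f0.
    apply: in_ideal homf _; have := dvdp_XsubCl (along (vpick o) v f) 0.
    by rewrite j1 expr1 subr0 /root horner_along scale0r addr0 f0 eqxx.
  by [].
move=> e f homf; split=> [If|]; last by rewrite -Ej; apply: in_ideal homf.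
have : g %| along (vpick o) v f by apply: dvd_g; exists e, f.
by rewrite Dg Ej dvdpZl.
Qed.

End TangentVector.

(** * Directional derivatives *)

Section Derivative.
Variables (K : closedFieldType) (n : nat).
Implicit Types (f g : {mpoly K[n.+1]}) (o u v x : 'rV[K]_n.+1).

Definition dirderiv o v f : K := \sum_i v ord0 i * f^`M(i).[: o].

Lemma dirderivDZ o u v c f :
  dirderiv o (u + c *: v) f = dirderiv o u f + c * dirderiv o v f.
Proof.
rewrite /dirderiv mulr_sumr -big_split; apply: eq_bigr => i _.
by rewrite !mxE mulrDl mulrA.
Qed.

Lemma dirderivZ o a v f : dirderiv o (a *: v) f = a * dirderiv o v f.
Proof.
by rewrite /dirderiv mulr_sumr; apply: eq_bigr => i _; rewrite mxE mulrA.
Qed.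

Lemma dirderivM o v f g :
  dirderiv o v (f * g) = dirderiv o v f * g.[: o] + f.[: o] * dirderiv o v g.
Proof.
rewrite /dirderiv mulr_suml mulr_sumr -big_split; apply: eq_bigr => i _.
by rewrite mderivM mevalD !mevalM /=; ring.
Qed.

Lemma along1E o v f : (along o v f)`_1 = dirderiv o v f.
Proof.
elim/mpoly_ring_ind: f => [c|i|g h|g h].
- rewrite /dirderiv /along mmapC coefC big1 // => i _.
  by rewrite mderivC meval0 mulr0.
- rewrite /dirderiv /along mmapX mmap1U coefD coefC coefZ coefX add0r mulr1.
  rewrite (bigD1 i) //= big1 ?addr0 => [|j ji].
    rewrite mderivX mnm1E eqxx scale1r (_ : (_ - _)%MM = 0%MM).
      by rewrite mpolyX0 meval1 mulr1.
    by apply/mnmP => j; rewrite mnmBE subnn mnm0E.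
  by rewrite mderivX mnm1E eq_sym (negPf ji) scale0r meval0 mulr0.
- rewrite /dirderiv rmorphD coefD => -> ->; rewrite -big_split.
  by apply: eq_bigr => i _; rewrite mderivD mevalD mulrDr.
rewrite rmorphM coefM big_ord_recl big_ord1 /= /bump /= subn0 subnn.
by rewrite !along0E dirderivM => -> ->; rewrite addrC mulrC.
Qed.

Lemma dirderiv_linform o v a : dirderiv o v (linform a) = (linform a).[: v].
Proof.
by rewrite -along1E along_linform coefD coefC coefZ coefX add0r mulr1.
Qed.

Lemma along_dvdX2 o v f :
  ('X^2 %| along o v f) = (f.[: o] == 0) && (dirderiv o v f == 0).
Proof.
rewrite -along1E -(along0E o v); set p := along o v f.
apply/idP/andP => [/dvdpP[q ->]|[/eqP p0 /eqP p1]].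
  by rewrite !coefMXn /= eqxx.
rewrite -[p](poly_take_drop 2) dvdp_addl ?dvdp_mulIr //.
suff -> : take_poly 2 p = 0 by rewrite dvdp0.
apply/polyP => i; rewrite coef_take_poly coef0.
by case: i => [|[|i]] //=.
Qed.

(** Restrict to the line spanned by o: f((1 + T) o) = (1 + T)^e f(o). *)
Lemma euler_homog o e f : f \is e.-homog -> dirderiv o o f = e%:R * f.[: o].
Proof.
move=> homf; rewrite -along1E.
have -> : along o o f = f.[: o] *: ('X + 1) ^+ e.
  apply/eqP; rewrite -subr_eq0; apply/eqP.
  apply: poly0_of_nonzero_roots => c _.
  have Ec : (along o o f).[c] = (c + 1) ^+ e * f.[: o].
    by rewrite horner_along -(eval_homogZ _ _ homf) scalerDl scale1r addrC.
  by rewrite hornerD Ec !hornerE mulrC subrr.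
rewrite coefZ mulrC; congr (_ * _).
have := coef_deriv (('X + 1 : {poly K}) ^+ e) 0; rewrite mulr1n => <-.
rewrite -horner_coef0 deriv_exp derivD derivX derivC addr0 mul1r.
by rewrite hornerMn !hornerE expr1n.
Qed.

Lemma mnm_neq0P (m : 'X_{1..n.+1}) : m != 0%MM -> exists i, (0 < m i)%N.
Proof.
rewrite -mdeg_eq0 mdegE => nz; apply/existsP; apply: contraNT nz => /existsPn m0.
by rewrite big1 // => i _; apply/eqP; rewrite -leqn0 leqNgt m0.
Qed.

Lemma eval0_coef f : f.[: (0 : 'rV[K]_n.+1)] = f@_0%MM.
Proof.
rewrite (mpolyE f) !raddf_sum; apply: eq_bigr => m _.
rewrite /= mevalZ mcoeffZ mcoeffX mevalX; congr (_ * _).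
case: eqVneq => [->|/mnm_neq0P[i im]].
  by rewrite big1 // => i _; rewrite mnm0E expr0.
by rewrite (bigD1 i) //= mxE expr0n gtn_eqF // mul0r.
Qed.

(** Iterated derivatives of a function vanishing everywhere read off its
    coefficients, which is where the characteristic enters. *)
Lemma mpoly_eq0_of_eval (charK0 : [pchar K] =i pred0) f :
  (forall x : 'rV[K]_n.+1, f.[: x] = 0) -> f = 0.
Proof.
move=> f0; apply/mpolyP => m; rewrite mcoeff0.
have [k] := ubnP (mdeg m); elim: k m f f0 => // k IHk m f f0 lt_mk.
have [->|/mnm_neq0P[i im]] := eqVneq m 0%MM; first by rewrite -eval0_coef.
have mE : m = (m - U_(i) + U_(i))%MM.
  by rewrite submK //; apply/mnm_lepP => j; rewrite mnm1E; case: eqVneq => // <-.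
have := IHk (m - U_(i))%MM f^`M(i).
rewrite mcoeff_mderiv -mE -mulr_natr => f'0.
have /eqP : f@_m * ((m - U_(i))%MM i).+1%:R = 0.
  apply: f'0 => [x|]; last by move: lt_mk; rewrite {1}mE mdegD mdeg1 addn1.
  have := along1E x (delta_mx ord0 i) f.
  have -> : along x (delta_mx ord0 i) f = 0.
    by apply: poly0_of_nonzero_roots => c _; rewrite horner_along.
  rewrite coef0 /dirderiv (bigD1 i) //= big1 ?addr0 => [|j ji].
    by rewrite mxE !eqxx mul1r.
  by rewrite mxE eqxx (negPf ji) mul0r.
by rewrite mulf_eq0 (iffLR (pcharf0P K) charK0) orbF => /eqP.
Qed.

End Derivative.

(** * Linear forms on the space of the Veronese variety *)

Section Hyperplane.
Variables (K : closedFieldType) (n : nat).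
Implicit Types (f g h : {mpoly K[n.+1]}) (a x y : 'rV[K]_n.+1).

(** With a(e) = 1, a form agrees modulo a with its composition with the
    projection y - a(y) e onto the hyperplane. *)
Lemma vanish_on_hyperplane (charK0 : [pchar K] =i pred0) a g : a != 0 ->
  (forall y, (linform a).[: y] = 0 -> g.[: y] = 0) ->
  exists h, g = linform a * h.
Proof.
move=> nza ag.
have [e ae] : exists e : 'rV[K]_n.+1, (linform a).[: e] = 1.
  have /rV0Pn[i nzi] := nza.
  exists ((a ord0 i)^-1 *: delta_mx ord0 i).
  rewrite eval_linform (bigD1 i) //= big1 ?addr0 => [|j ji].
    by rewrite !mxE !eqxx mulr1 mulfV.
  by rewrite !mxE (negPf ji) andbF !mulr0.
pose s := [tuple ('X_i - e ord0 i *: linform a : {mpoly K[n.+1]}) | i < n.+1].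
have [h Eh] : exists h, g - (g \mPo s) = linform a * h.
  elim/mpoly_ring_ind: {ag} g => [c|i|f h [f' Ef] [h' Eh]|f h [f' Ef] [h' Eh]].
  - by exists 0; rewrite comp_mpolyC mulr0 subrr.
  - exists (e ord0 i)%:MP; rewrite comp_mpolyXU -tnth_nth tnth_mktuple.
    by rewrite mulrC mul_mpolyC opprB addrCA subrr addr0.
  - by exists (f' + h'); rewrite mulrDr -Ef -Eh rmorphD /=; ring.
  exists (f' * h + (f \mPo s) * h').
  transitivity ((f - (f \mPo s)) * h + (f \mPo s) * (h - (h \mPo s))).
    by rewrite rmorphM /=; ring.
  by rewrite Ef Eh; ring.
exists h; rewrite -Eh; suff -> : g \mPo s = 0 by rewrite subr0.
apply: (mpoly_eq0_of_eval charK0) => x; rewrite comp_mpoly_meval.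
have <- : g.[: x + (- (linform a).[: x]) *: e] = 0.
  by apply: ag; rewrite eval_linformDZ ae mulr1 subrr.
apply: meval_eq => i; rewrite tnth_mktuple mevalB mevalXU mevalZ !mxE.
by rewrite mulNr mulrC.
Qed.

Lemma hyperplane_space a : exists V : {vspace 'rV[K]_n.+1},
  (n <= \dim V)%N /\ forall y, (y \in V) = ((linform a).[: y] == 0).
Proof.
pose l := linfun (mulmxr a^T : 'rV[K]_n.+1 -> 'M[K]_1).
exists (lker l); split=> [|y].
  have dim_l : (\dim (lker l) + \dim (limg l) = 1 * n.+1)%N.
    by have := limg_ker_dim l fullv; rewrite capfv dimvf.
  have : (\dim (limg l) <= 1 * 1)%N.
    by have := dimvS (subvf (limg l)); rewrite dimvf.
  move=> le1; rewrite -(leq_add2r (\dim (limg l)) n) dim_l.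
  by apply: (leq_trans (leq_add (leqnn n) le1)); lia.
rewrite memv_ker lfunE /= eval_linform.
have -> : \sum_i a ord0 i * y ord0 i = (y *m a^T) ord0 ord0.
  by rewrite mxE; apply: eq_bigr => i _; rewrite mxE mulrC.
apply/eqP/eqP => [->|y0]; first by rewrite mxE.
by apply/matrixP => i j; rewrite !ord1 y0 mxE.
Qed.

End Hyperplane.

Section Apolar.
Variables (K : closedFieldType) (m d : nat).
Local Notation N := (veronese_dim m d).
Local Notation mon := (@veronese_monomial m d).
Implicit Types (f g : {mpoly K[m.+1]}) (y : 'rV[K]_N.+1) (v : 'rV[K]_m.+1).

(** A vector of the ambient space of the Veronese variety as a functional on
    forms of degree d; the vectors of the Veronese cone are the evaluations. *)
Definition apolar y f : K := \sum_i y ord0 i * f@_(mon i).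

Fact apolar_is_additive y : additive (apolar y).
Proof.
move=> f g; rewrite /apolar -sumrB; apply: eq_bigr => i _.
by rewrite mcoeffB mulrBr.
Qed.
HB.instance Definition _ y :=
  GRing.isAdditive.Build {mpoly K[m.+1]} K (apolar y) (apolar_is_additive y).

Lemma apolarZ y c f : apolar y (c *: f) = c * apolar y f.
Proof.
by rewrite mulr_sumr; apply: eq_bigr => i _; rewrite mcoeffZ mulrCA.
Qed.

Lemma apolarDl y y' f : apolar (y + y') f = apolar y f + apolar y' f.
Proof.
by rewrite -big_split; apply: eq_bigr => i _; rewrite mxE mulrDl.
Qed.

Lemma apolar_sum (I : Type) (r : seq I) (c : I -> K) (Y : I -> 'rV[K]_N.+1) f :
  apolar (\sum_(j <- r) c j *: Y j) f = \sum_(j <- r) c j * apolar (Y j) f.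
Proof.
rewrite /apolar; under [RHS]eq_bigr do rewrite mulr_sumr.
rewrite exchange_big; apply: eq_bigr => i _.
rewrite summxE mulr_suml; apply: eq_bigr => j _.
by rewrite mxE mulrA.
Qed.

Lemma mdeg_mon i : mdeg (mon i) = d.
Proof.
by apply/eqP; rewrite -mem_degree_monomials mem_nth ?size_degree_monomials.
Qed.

Lemma mon_inj : injective mon.
Proof.
move=> i j /eqP; rewrite nth_uniq ?size_degree_monomials ?uniq_degree_monomials //.
by move/eqP/val_inj.
Qed.

Lemma mon_surj a : mdeg a = d -> exists i, a = mon i.
Proof.
move/eqP; rewrite -mem_degree_monomials => amem.
have lt_i : (index a (degree_monomials m d) < N.+1)%N.
  by rewrite -size_degree_monomials index_mem.
by exists (Ordinal lt_i); rewrite /veronese_monomial nth_index.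
Qed.

Definition form_of y : {mpoly K[m.+1]} := \sum_i y ord0 i *: 'X_[mon i].

Lemma form_of_homog y : form_of y \is d.-homog.
Proof.
by apply: rpred_sum => i _; rewrite rpredZ // dhomogX /= mdeg_mon.
Qed.

Lemma coef_form_of y i : (form_of y)@_(mon i) = y ord0 i.
Proof.
rewrite raddf_sum (bigD1 i) //= big1 ?addr0 => [|j ji].
  by rewrite mcoeffZ mcoeffX eqxx mulr1.
by rewrite mcoeffZ mcoeffX (inj_eq mon_inj) (negPf ji) mulr0.
Qed.

Lemma homog_form_of f : f \is d.-homog -> f = form_of (\row_i f@_(mon i)).
Proof.
move=> homf; apply/mpolyP => a; have [da|da] := eqVneq (mdeg a) d.
  by have [i ->] := mon_surj da; rewrite coef_form_of mxE.
by rewrite (dhomog_nemf_coeff homf da) (dhomog_nemf_coeff (form_of_homog _) da).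
Qed.

Lemma apolar_form_of y a : apolar y (form_of a) = (linform a).[: y].
Proof.
rewrite eval_linform; apply: eq_bigr => i _.
by rewrite coef_form_of mulrC.
Qed.

Lemma apolar_veronese v f : f \is d.-homog ->
  apolar (veronese_vector d v) f = f.[: v].
Proof.
move=> /homog_form_of ->; rewrite apolar_form_of eval_linform [RHS]raddf_sum.
by apply: eq_bigr => i _; rewrite /= mevalZ !mxE.
Qed.

Lemma apolar_mon y i : apolar y 'X_[mon i] = y ord0 i.
Proof.
rewrite /apolar (bigD1 i) //= big1 ?addr0 => [|j ji].
  by rewrite mcoeffX eqxx mulr1.
by rewrite mcoeffX (inj_eq mon_inj) eq_sym (negPf ji) mulr0.
Qed.

Lemma apolar_ext y y' :
  (forall f, f \is d.-homog -> apolar y f = apolar y' f) -> y = y'.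
Proof.
move=> eq_y; apply/rowP => i; rewrite -!apolar_mon; apply: eq_y.
by rewrite dhomogX /= mdeg_mon.
Qed.

Lemma pullback_linform a : veronese_pullback (linform a) = form_of a.
Proof.
rewrite /veronese_pullback raddf_sum; apply: eq_bigr => i _.
by rewrite /= comp_mpolyZ comp_mpolyXU -tnth_nth tnth_mktuple.
Qed.

Lemma image_linform (C : subscheme K m) a :
  ideal_of (veronese_image d C) (linform a) <-> ideal_of C (form_of a).
Proof.
have := ideal_forms (image_ideal0 d C) (linform_homog a).
by rewrite /image_ideal pullback_linform.
Qed.

(** The hyperplanes containing the images of B and C are the forms of degree d
    in both ideals.  To test this on the whole ideal of a hyperplane, divide by
    its equation. *)
Lemma in_span_images (charK0 : [pchar K] =i pred0) (N_gt0 : (0 < N)%N) (B C : subscheme K m)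
    (P : ppoint K N) :
  in_span (union_scheme (veronese_image d B) (veronese_image d C)) P <->
  forall f, f \is d.-homog -> ideal_of B f -> ideal_of C f ->
    apolar (vpick P) f = 0.
Proof.
split=> [spanP f homf Bf Cf|killP V subV].
  rewrite (homog_form_of homf) in Bf Cf *; set a := \row_i _ in Bf Cf *.
  rewrite apolar_form_of; have [->|nza] := eqVneq a 0.
    by rewrite eval_linform big1 // => i _; rewrite mxE mul0r.
  have [V [dimV VE]] := hyperplane_space a.
  apply/eqP; rewrite -VE -ppoint_le; apply: spanP => g Vg.
  apply: ideal_components => e.
  have [h ->] : exists h, pihomog mdeg e g = linform a * h.
    apply: vanish_on_hyperplane => // y ay0.
    have homg := pihomogP mdeg e g.
    have := ideal_homog e Vg; case: (posnP e) homg => [-> homg|e_gt0 homg].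
      have nzV : V != 0%VS by rewrite -dimv_eq0 -lt0n (leq_trans N_gt0).
      have nzv : vpick V != 0 by rewrite vpick0.
      move/(ideal_closure _ homg)/(_ (ppoint_of nzv)); rewrite -memvE memv_pick.
      move=> /(_ isT) g0; transitivity (pihomog mdeg 0 g).[: 0 *: y].
        by rewrite (eval_homogZ _ _ homg) expr0 mul1r.
      rewrite scale0r -(scale0r (vpick (ppoint_of nzv))).
      by rewrite (eval_homogZ _ _ homg) g0 mulr0.
    by move/(ideal_linear _ homg e_gt0); apply; rewrite VE ay0.
  rewrite mulrC; split; apply: idealM; exact/image_linform.
rewrite ppoint_le; apply/negPn/negP => PV.
have [a [aV aP]] := separating_linform PV.
have [Ba Ca] : ideal_of (union_scheme (veronese_image d B) (veronese_image d C)) (linform a).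
  by apply: subV; apply/(ideal_linear _ (linform_homog a)).
case/negP: aP; rewrite -apolar_form_of; apply/eqP; apply: killP.
- exact: form_of_homog.
- exact/image_linform.
- exact/image_linform.
Qed.

End Apolar.

(** * Linear relations between evaluations at points *)

Lemma sub_in_count (T : eqType) (a b : pred T) (s : seq T) :
  {in s, forall x, a x -> b x} -> (count a s <= count b s)%N.
Proof.
elim: s => //= x s IHs ab; apply: leq_add.
  by have := ab x (mem_head x s); case: (a x) => // ->.
by apply: IHs => y ys; apply: ab; rewrite inE ys orbT.
Qed.

Section Relations.
Variables (K : closedFieldType) (n : nat).
Implicit Types (f g : {mpoly K[n.+1]}) (p q o : ppoint K n) (v : 'rV[K]_n.+1).
Implicit Types (s : seq (ppoint K n)) (V D : {vspace 'rV[K]_n.+1}).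
Implicit Types (e : ppoint K n -> K).

Definition off V s := [seq p <- s | ~~ (line_of p <= V)%VS].

Lemma mem_off V s p : (p \in off V s) = ~~ (line_of p <= V)%VS && (p \in s).
Proof. by rewrite mem_filter. Qed.

Lemma off_nil V s : off V s = [::] -> forall p, p \in s -> (line_of p <= V)%VS.
Proof.
move=> off0 p ps; apply: contraT => pV.
by have := mem_off V s p; rewrite off0 pV ps.
Qed.

Lemma size_off_off V D s : (forall p, p \in off V s -> (line_of p <= D)%VS) ->
  (size (off D s) + size (off V s) <= size s)%N.
Proof.
move=> VD; rewrite !size_filter -(count_predC (fun p => (line_of p <= D)%VS) s).
rewrite addnC leq_add2r; apply/sub_in_count => p ps pV /=.
by apply: VD; rewrite mem_off pV.
Qed.

Lemma size_off V s (s' : seq (ppoint K n)) : uniq s' ->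
  {subset s' <= s} -> (forall p, p \in s' -> (line_of p <= V)%VS) ->
  (size (off V s) + size s' <= size s)%N.
Proof.
move=> us' s's s'V; rewrite size_filter -(count_predC (fun p => (line_of p <= V)%VS) s).
rewrite addnC leq_add2r -size_filter uniq_leq_size // => p ps'.
by rewrite mem_filter s'V ?s's.
Qed.

Definition relation k s e : Prop :=
  [/\ uniq s, forall p, p \in s -> e p != 0
    & forall f, f \is k.-homog -> \sum_(p <- s) e p * f.[: vpick p] = 0].

Lemma off_linform V s : exists a,
  (forall y, y \in V -> (linform a).[: y] = 0) /\
  forall p, p \in off V s -> (linform a).[: vpick p] != 0.
Proof.
have [x|a [aV nza]] := @avoiding_linform _ _ V [seq vpick p | p <- off V s].
  by case/mapP => p; rewrite mem_off ppoint_le => /andP[pV _] ->.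
by exists a; split=> // p ps; apply/nza/map_f.
Qed.

Lemma sum_off V s e a f : (forall y, y \in V -> (linform a).[: y] = 0) ->
  \sum_(p <- s) e p * (linform a * f).[: vpick p] =
  \sum_(p <- off V s) (e p * (linform a).[: vpick p]) * f.[: vpick p].
Proof.
move=> aV; rewrite big_filter [RHS]big_mkcond; apply: eq_bigr => p _ /=.
case: ifP => [_|/negbFE]; first by rewrite mevalM mulrA.
by rewrite ppoint_le => /aV a0; rewrite mevalM a0 mul0r mulr0.
Qed.

(** Apply the relation to multiples of a hyperplane that contains V and no
    further point of s: the elementary form of the residual exact sequence. *)
Lemma residual_relation k V s e : relation k.+1 s e ->
  exists e', relation k (off V s) e'.
Proof.
move=> [us nze rel]; have [a [aV nza]] := off_linform V s.
exists (fun p => e p * (linform a).[: vpick p]); split.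
- exact: filter_uniq.
- move=> p ps; rewrite mulf_neq0 ?nza ?nze //.
  by move: ps; rewrite mem_off => /andP[].
- move=> f homf; rewrite -(sum_off _ _ _ aV).
  exact/rel/linformM_homog.
Qed.

Lemma off_cons_line p s : uniq (p :: s) -> off (line_of p) (p :: s) = s.
Proof.
move=> /andP[ps _]; rewrite /off /= subvv /=; apply/all_filterP/allP => q qs.
by rewrite ppoint_le ppoint_eq_mem; apply: contraNneq ps => <-.
Qed.

Lemma no_relation_point k p e : ~ relation k [:: p] e.
Proof.
move=> [_ nze rel]; have [//|x|//|f [homf _ fp]] :=
  @avoiding_form _ n [::] [:: vpick p] k.
  by rewrite inE => /eqP->; apply: vpick_neq0.
have := rel f homf; rewrite big_seq1 => /eqP.
by rewrite mulf_eq0 (negPf (nze p _)) ?mem_head // (negPf (fp _ _)) ?mem_head.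
Qed.

(** Remove one point at a time, down to a single point. *)
Lemma relation_size k s e : relation k s e -> s != [::] -> (k.+2 <= size s)%N.
Proof.
elim: k s e => [|k IHk] [//|p [|q s]] e rel _ //; try by case: (no_relation_point rel).
have [us _ _] := rel; have [e' rel'] := residual_relation (line_of p) rel.
by rewrite off_cons_line // in rel'; apply: (IHk _ _ rel').
Qed.

Lemma dim_span2 p q : (\dim (line_of p + line_of q)%VS <= 2)%N.
Proof. by have := (dimv_add_leqif (line_of p) (line_of q)).1; rewrite !dim_ppoint. Qed.

(** Remove the line M through two of the points.  If points remain, they lie by
    induction on a line D and are at least k + 1; so few points are then outside
    D that none is. *)
Lemma relation_line k s e : relation k s e -> (size s <= k.*2.+1)%N ->
  exists2 D, (\dim D <= 2)%N & forall p, p \in s -> (line_of p <= D)%VS.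
Proof.
elim: k s e => [|k IHk] [|p [|q s]] e rel //.
- by move=> _; exists 0%VS; rewrite ?dimv0.
- by move=> _; exists (line_of p); rewrite ?dim_ppoint // => x; rewrite inE => /eqP->.
- by move=> _; exists 0%VS; rewrite ?dimv0.
- by move=> _; exists (line_of p); rewrite ?dim_ppoint // => x; rewrite inE => /eqP->.
move=> le_s; set s0 := [:: p, q & s] in rel le_s *.
have us0 : uniq s0 by case: rel.
pose M := (line_of p + line_of q)%VS.
have [e' relM] := residual_relation M rel.
have sizeM : (size (off M s0) + 2 <= size s0)%N.
  apply: (@size_off M s0 [:: p; q]).
  - by move: us0; rewrite /s0 /= !inE negb_or => /and3P[/andP[pq _] _ _]; rewrite andbT.
  - by move=> x; rewrite !inE => /orP[]->; rewrite ?orbT.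
  - by move=> x; rewrite !inE => /orP[]/eqP->; rewrite ?addvSl ?addvSr.
have [offM|nzoff] := eqVneq (off M s0) [::].
  by exists M; [apply: dim_span2 | apply: off_nil].
have [|D dimD DM] := IHk _ _ relM; first by rewrite doubleS in le_s; lia.
exists D => //; have [e'' relD] := residual_relation D rel.
apply: off_nil; apply/eqP; apply: contraT => /(relation_size relD).
have := size_off_off DM; have := relation_size relM nzoff; rewrite doubleS in le_s.
by lia.
Qed.

(** Remove a plane through three points.  What remains is by induction on a
    plane or on two lines; if it has at most 2 k - 1 points it is on one line by
    the preceding lemma.  In each case removing the plane, or the line with more
    points, leaves so few points that they are on a line or absent. *)
Lemma relation_plane_or_lines k s e : relation k s e -> (size s < 3 * k)%N ->
  (exists2 D, (\dim D <= 3)%N & forall p, p \in s -> (line_of p <= D)%VS) \/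
  exists D1 D2, [/\ (\dim D1 <= 2)%N, (\dim D2 <= 2)%N &
    forall p, p \in s -> (line_of p <= D1)%VS || (line_of p <= D2)%VS].
Proof.
elim: k s e => [|k IHk] s e rel; first by rewrite muln0.
move=> lt_s.
have [[p [q [w [ps qs ws uw wD]]]]|few] := classic (exists p q w,
    [/\ p \in s, q \in s, w \in s, uniq [:: p; q; w]
      & ~~ (line_of w <= line_of p + line_of q)%VS]); last first.
  left; case: s rel lt_s few => [|p [|q s]] rel lt_s few.
  - by exists 0%VS; rewrite ?dimv0.
  - by exists (line_of p); rewrite ?dim_ppoint // => x; rewrite inE => /eqP->.
  - exists (line_of p + line_of q)%VS.
      by apply: (leq_trans (dim_span2 p q)).
    move=> w ws; apply: contraT => wD; case: few; exists p, q, w.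
    have wp : w != p by apply: contraNneq wD => ->; apply: addvSl.
    have wq : w != q by apply: contraNneq wD => ->; apply: addvSr.
    have [us _ _] := rel; split=> //; rewrite ?mem_head ?inE ?eqxx ?orbT //=.
    move: us; rewrite /= !inE !negb_or => /andP[/andP[-> _] _].
    by rewrite ![_ == w]eq_sym wp wq.
pose D := (line_of p + line_of q + line_of w)%VS.
have dimD : (\dim D <= 3)%N.
  apply: leq_trans (dimv_add_leqif _ _).1 _.
  by rewrite dim_ppoint -[3%N]/(2 + 1)%N leq_add2r dim_span2.
have [e1 rel1] := residual_relation D rel; set s1 := off D s in rel1.
have size1 : (size s1 + 3 <= size s)%N.
  apply: (@size_off D s [:: p; q; w]) => //.
  - by move=> x; rewrite !inE => /or3P[]/eqP->.
  - move=> x; rewrite !inE /D => /or3P[]/eqP->; last exact: addvSr.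
      exact: subv_trans (addvSl _ _) (addvSl _ _).
    exact: subv_trans (addvSr _ _) (addvSl _ _).
have [s10|nzs1] := eqVneq s1 [::]; first by left; exists D => //; apply: off_nil.
have le_s1 := relation_size rel1 nzs1.
have [small|big1] := leqP (size s1) k.*2.+1.
  have [D1 dimD1 D1s] := relation_line rel1 small.
  have [e2 rel2] := residual_relation D1 rel.
  have := size_off_off D1s; rewrite -/s1 => size2.
  have [|D2 dimD2 D2s] := relation_line rel2; first by lia.
  right; exists D1, D2; split=> // x xs; have [//|xD1] := boolP (line_of x <= D1)%VS.
  by rewrite D2s ?orbT // mem_off xD1.
have [|[D1 dimD1 D1s]|[D1 [D2 [dimD1 dimD2 Ds]]]] := IHk _ _ rel1; first by lia.
  left; exists D1 => //; have [e2 rel2] := residual_relation D1 rel.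
  apply: off_nil; apply/eqP; apply: contraT => /(relation_size rel2).
  by have := size_off_off D1s; rewrite -/s1; lia.
have half E : (\dim E <= 2)%N ->
    (k.+1 <= count (fun x => (line_of x <= E)%VS) s1)%N ->
    exists D1 D2, [/\ (\dim D1 <= 2)%N, (\dim D2 <= 2)%N &
      forall x, x \in s -> (line_of x <= D1)%VS || (line_of x <= D2)%VS].
  move=> dimE cntE; have [e2 rel2] := residual_relation E rel.
  have sizeE : (size (off E s) + k.+1 <= size s)%N.
    apply: leq_trans (leq_add (leqnn _) cntE) _; rewrite -size_filter.
    apply: size_off.
    - by rewrite !filter_uniq //; case: rel.
    - by move=> x; rewrite mem_filter mem_off => /and3P[].
    - by move=> x; rewrite mem_filter => /andP[].
  have [|D' dimD' D's] := relation_line rel2; first by lia.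
  exists E, D'; split=> // x xs; have [//|xE] := boolP (line_of x <= E)%VS.
  by rewrite D's ?orbT // mem_off xE.
right; have [le1|lt1] := leqP k.+1 (count (fun x => (line_of x <= D1)%VS) s1).
  exact: half le1.
apply: (half D2) => //.
have := count_predC (fun x => (line_of x <= D1)%VS) s1.
have : (count (predC (fun x => (line_of x <= D1)%VS)) s1 <=
        count (fun x => (line_of x <= D2)%VS) s1)%N.
  by apply: sub_in_count => x /Ds + /= /negPf xD1; rewrite xD1.
by lia.
Qed.

End Relations.

Section TangentRelations.
Variables (K : closedFieldType) (n : nat) (o : ppoint K n) (v : 'rV[K]_n.+1).
Hypothesis vo : v \notin line_of o.
Implicit Types (f g : {mpoly K[n.+1]}) (p q : ppoint K n).
Implicit Types (s : seq (ppoint K n)) (V D : {vspace 'rV[K]_n.+1}).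
Implicit Types (e : ppoint K n -> K).
Local Notation L := (line_of o + <[v]>)%VS.

(** A relation with a double point at o in the direction v; a is the coefficient
    of the derivative. *)
Definition tangent_relation k s e : Prop :=
  [/\ uniq s, o \notin s, forall p, p \in s -> e p != 0
    & exists a b, a != 0 /\ forall f, f \is k.-homog ->
        a * dirderiv (vpick o) v f + b * f.[: vpick o]
          + \sum_(p <- s) e p * f.[: vpick p] = 0].

Lemma tangent_residual_away k V s e : tangent_relation k.+1 s e ->
  ~~ (line_of o <= V)%VS -> exists e', tangent_relation k (off V s) e'.
Proof.
move=> [us os nze [a [b [nza rel]]]] oV.
have [c [cV nzc]] := off_linform V (o :: s).
have oc : (linform c).[: vpick o] != 0 by apply: nzc; rewrite mem_off oV mem_head.
exists (fun p => e p * (linform c).[: vpick p]); split.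
- exact: filter_uniq.
- by rewrite mem_off (negPf os) andbF.
- move=> p; rewrite mem_off => /andP[pV ps].
  by rewrite mulf_neq0 ?nze ?nzc // mem_off pV inE ps orbT.
exists (a * (linform c).[: vpick o]),
  (a * (linform c).[: v] + b * (linform c).[: vpick o]).
split=> [|f homf]; first exact: mulf_neq0.
rewrite -(sum_off _ _ _ cV) -[RHS](rel _ (linformM_homog c homf)).
by rewrite dirderivM dirderiv_linform mevalM; ring.
Qed.

(** The derivative of a multiple of a hyperplane through o is a value at o. *)
Lemma tangent_residual_through k V s e : tangent_relation k.+1 s e ->
  (line_of o <= V)%VS -> v \notin V -> exists e', relation k (o :: off V s) e'.
Proof.
move=> [us os nze [a [b [nza rel]]]] oV vV.
have [x|c [cV nzc]] := @avoiding_linform _ _ V (v :: [seq vpick p | p <- off V s]).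
  rewrite inE => /predU1P[->//|/mapP[p]].
  by rewrite mem_off ppoint_le => /andP[pV _] ->.
pose e' p := if p == o then a * (linform c).[: v] else e p * (linform c).[: vpick p].
have e'E p : p \in s -> e' p = e p * (linform c).[: vpick p].
  by move=> ps; rewrite /e' ifN //; apply: contraNneq os => <-.
exists e'; split.
- by rewrite /= mem_off (negPf os) andbF filter_uniq.
- move=> p; rewrite inE => /predU1P[->|ps].
    by rewrite /e' eqxx mulf_neq0 // nzc // mem_head.
  have := ps; rewrite mem_off => /andP[_ ps']; rewrite e'E //.
  by rewrite mulf_neq0 ?nze //; apply: nzc; rewrite inE (map_f (fun q : ppoint K n => vpick q) ps) orbT.
move=> f homf; rewrite big_cons /e' eqxx -/e'.
rewrite big_seq (eq_bigr (fun p => e p * (linform c).[: vpick p] * f.[: vpick p])).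
  rewrite -big_seq -(sum_off _ _ _ cV) -[RHS](rel _ (linformM_homog c homf)).
  rewrite dirderivM dirderiv_linform mevalM (cV (vpick o)) -?ppoint_le //; ring.
by move=> p; rewrite mem_off => /andP[_ ps]; rewrite -/(e' p) e'E.
Qed.

Lemma tangent_residual_line k V s e : tangent_relation k.+1 s e ->
  (L <= V)%VS -> exists e', relation k (off V s) e'.
Proof.
move=> [us os nze [a [b [nza rel]]]] LV.
have oV : vpick o \in V by rewrite -ppoint_le (subv_trans (addvSl _ _) LV).
have vV : v \in V by rewrite memvE (subv_trans (addvSr _ _) LV).
have [c [cV nzc]] := off_linform V s.
exists (fun p => e p * (linform c).[: vpick p]); split.
- exact: filter_uniq.
- move=> p ps; have := ps; rewrite mem_off => /andP[_ ps'].
  by rewrite mulf_neq0 ?nze ?nzc.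
move=> f homf; rewrite -(sum_off _ _ _ cV) -[RHS](rel _ (linformM_homog c homf)).
by rewrite dirderivM dirderiv_linform mevalM !cV //; ring.
Qed.

(** A double point needs k further points: a hyperplane through o transverse to
    the tangent vector turns it into a simple point. *)
Lemma tangent_relation_size k s e : tangent_relation k s e -> (k <= size s)%N.
Proof.
case: k => // k rel.
have [e' rel'] := tangent_residual_through rel (subvv _) vo.
have := relation_size rel' isT; rewrite /= !ltnS => le_k.
by rewrite (leq_trans le_k) // size_filter count_size.
Qed.

Lemma tangent_relation_off k V s e : tangent_relation k.+1 s e ->
  ~~ (L <= V)%VS -> (k <= size (off V s))%N.
Proof.
move=> rel; rewrite subv_add -memvE; have [oV|oV] := boolP (line_of o <= V)%VS.
  move=> /= vV; have [e' rel'] := tangent_residual_through rel oV vV.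
  by have := relation_size rel' isT; rewrite /= !ltnS; apply: ltnW.
have [e' rel'] := tangent_residual_away rel oV => _.
exact: tangent_relation_size rel'.
Qed.

Lemma dim_tangent_line : \dim L = 2%N.
Proof.
apply/eqP; rewrite eqn_leq; apply/andP; split.
  apply: leq_trans (dimv_add_leqif _ _).1 _.
  by rewrite dim_ppoint dim_vline ltnS leq_b1.
rewrite ltnNge; apply: contra vo => dimL.
have /eqP -> : line_of o == L by rewrite eqEdim addvSl dim_ppoint.
by rewrite memvE addvSr.
Qed.

(** If R is empty, W has at least k points.  Otherwise removing L leaves a
    relation between points W2 in degree k - 1, whose size forces it onto a
    line, a plane or two lines, and shows that at most 2 #R - 1 - k points of W
    are on L unless W2 is on one line.  If W2 is on one line, it contains at
    most two points of R; in the other cases #R is at least three.  So L is not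
    in the line or plane, since R is off L and o :: R is in general position,
    and one of two lines contains two points of R and hence not o.  Removing the
    line, the plane or both lines instead of L keeps the derivative or the value
    at o, with fewer other points than such a relation has. *)
Lemma no_short_tangent_relation k W e (R : seq (ppoint K n)) : (4 <= k)%N ->
  tangent_relation k W e -> uniq R -> {subset R <= W} ->
  (forall p, p \in R -> ~~ (line_of p <= L)%VS) ->
  (forall V, (\dim V <= 3)%N ->
     (count (fun p => (line_of p <= V)%VS) (o :: R) <= \dim V)%N) ->
  (size R + 2 <= k)%N -> (size W < k + (size R).*2)%N -> False.
Proof.
case: k => // k k_ge4 rel uR RW RL lgp le_R lt_W.
have lgpR V : (\dim V <= 3)%N ->
    (count (fun p => (line_of p <= V)%VS) R <= \dim V)%N.
  by move=> dimV; apply: leq_trans (lgp V dimV); rewrite /= leq_addl.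
have [r0|r_gt0] := posnP (size R).
  by have := tangent_relation_size rel; rewrite r0 addn0 in lt_W; lia.
have [e2 rel2] := tangent_residual_line rel (subvv L).
set W2 := off L W in rel2.
have RW2 p : p \in R -> p \in W2 by move=> pR; rewrite mem_off RL ?RW.
have nzW2 : W2 != [::].
  by apply: contraTneq r_gt0 => W20; case: (R) RW2 => // p R' /(_ p (mem_head _ _)); rewrite W20.
have cntR V : (forall p, p \in W2 -> (line_of p <= V)%VS) ->
    count (fun p => (line_of p <= V)%VS) R = size R.
  by move=> W2V; apply/eqP; rewrite -all_count; apply/allP => p /RW2/W2V.
have line_eq V : (\dim V <= 2)%N -> (L <= V)%VS -> V = L.
  by move=> dimV LV; apply/esym/eqP; rewrite eqEdim LV dim_tangent_line.
have noR : count (fun p => (line_of p <= L)%VS) R = 0%N.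
  by apply/eqP; rewrite -leqn0 leqNgt -has_count; apply/hasPn.
have le_W2 := relation_size rel2 nzW2.
have le_W2W : (size W2 <= size W)%N by rewrite size_filter count_size.
have [small|big2] := leqP (size W2) k.*2.+1.
  have [D dimD DW2] := relation_line rel2 small.
  have LD : ~~ (L <= D)%VS.
    by apply/negP => /(line_eq _ dimD) ED; have := cntR D DW2; rewrite ED noR; lia.
  have := tangent_relation_off rel LD; have := size_off_off DW2; rewrite -/W2.
  by have := lgpR D (leqW dimD); rewrite (cntR D DW2); lia.
have [|[D dimD DW2]|[D1 [D2 [dimD1 dimD2 DW2]]]] := relation_plane_or_lines rel2.
- by lia.
- have LD : ~~ (L <= D)%VS.
    apply/negP => LD; have := lgp D dimD; rewrite /= (cntR D DW2).
    by rewrite (subv_trans (addvSl _ _) LD); lia.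
  have := tangent_relation_off rel LD; have := size_off_off DW2; rewrite -/W2.
  by lia.
(* The line E with two points of R avoids o, so that it keeps the double point. *)
have lines E E' : (\dim E <= 2)%N -> (\dim E' <= 2)%N ->
    (forall p, p \in W2 -> (line_of p <= E)%VS || (line_of p <= E')%VS) ->
    (1 < count (fun p => (line_of p <= E)%VS) R)%N -> False.
  move=> dimE dimE' EW2 RE.
  have oE : ~~ (line_of o <= E)%VS.
    by apply/negP => oE; have := lgp E (leqW dimE); rewrite /= oE; lia.
  have [e3 rel3] := tangent_residual_away rel oE.
  have LE' : ~~ (L <= E')%VS.
    apply/negP => /(line_eq _ dimE') EL; have := lgpR E (leqW dimE).
    have -> : count (fun p => (line_of p <= E)%VS) R = size R; last by lia.
    apply/eqP; rewrite -all_count; apply/allP => p pR.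
    by have := EW2 p (RW2 p pR); rewrite EL (negPf (RL p pR)) orbF.
  move: rel3 k_ge4 rel le_R lt_W rel2 le_W2 big2; case: k => // k rel3 *.
  have := tangent_relation_off rel3 LE'.
  have : (size (off E' (off E W)) + size W2 <= size W)%N.
    rewrite /off -filter_predI !size_filter addnC.
    rewrite -(count_predC (fun p => ~~ (line_of p <= L)%VS) W) leq_add2l.
    apply: sub_in_count => p pW /= /andP[pE' pE]; apply/negP => pL.
    by have := EW2 p; rewrite mem_off pL pW (negPf pE) (negPf pE') => /(_ isT).
  by lia.
have [le1|lt1] := ltnP 1 (count (fun p => (line_of p <= D1)%VS) R).
  exact: (lines D1 D2).
apply: (lines D2 D1) => // [p pW2|]; first by rewrite orbC DW2.
have := count_predC (fun x => (line_of x <= D1)%VS) R.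
have : (count (predC (fun x => (line_of x <= D1)%VS)) R <=
        count (fun x => (line_of x <= D2)%VS) R)%N.
  by apply: sub_in_count => x /RW2/DW2 + /= /negPf xD1; rewrite xD1.
by lia.
Qed.

End TangentRelations.

(** * Points in general position *)

Section GeneralPosition.
Variables (K : closedFieldType) (n : nat).
Implicit Types (f g : {mpoly K[n.+1]}) (p q o : ppoint K n).
Implicit Types (s : seq (ppoint K n)) (V D : {vspace 'rV[K]_n.+1}).

Lemma on_linear_scheme V p : (line_of p <= V)%VS -> on_scheme (linear_scheme V) p.
Proof. by move=> pV; apply: on_schemeP => e f homf /(ideal_closure _ homf); apply. Qed.

Lemma on_inter_scheme (B C : subscheme K n) p :
  on_scheme B p -> on_scheme C p -> on_scheme (inter_scheme B C) p.
Proof.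
move=> Bp Cp; apply: on_schemeP => e f _ If.
have /rV0Pn[i nzi] := vpick_neq0 p.
have [k [g [h [Bg Ch E]]]] := If i.
have /eqP := congr1 (fun f => f.[: vpick p]) E.
rewrite mevalM rmorphXn /= mevalXU mevalD (on_scheme_eval Bp Bg).
rewrite (on_scheme_eval Cp Ch) addr0 mulf_eq0 expf_eq0 (negPf nzi) andbF.
by move/eqP.
Qed.

Lemma on_union_scheme (B C : subscheme K n) p :
  on_scheme B p \/ on_scheme C p -> on_scheme (union_scheme B C) p.
Proof. by case=> Ip f [Bf Cf]; apply: Ip. Qed.

(** Points of a scheme are bounded by the degree of its intersection with V. *)
Lemma general_position_count (C : subscheme K n) s V :
  linearly_general_position C -> uniq s -> (forall p, p \in s -> on_scheme C p) ->
  (\dim V < n.+1)%N -> (count (fun p => (line_of p <= V)%VS) s <= \dim V)%N.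
Proof.
move=> lgp us Cs /lgp[k degk]; apply: leq_trans; rewrite -size_filter.
apply: points_le_degree degk _ _; first exact: filter_uniq.
move=> p; rewrite mem_filter => /andP[pV ps].
by apply: on_inter_scheme; [apply: Cs | apply: on_linear_scheme].
Qed.

Lemma pair_spans s : exists Vs, [/\ (size Vs <= uphalf (size s))%N,
  forall p, p \in s -> exists2 V, V \in Vs & (line_of p <= V)%VS
  & forall V, V \in Vs -> exists p q,
      [/\ p \in s, q \in s & V = (line_of p + line_of q)%VS]].
Proof.
have [k] := ubnP (size s); elim: k s => // k IHk [|p [|q s]] lt_s.
- by exists [::].
- exists [:: (line_of p + line_of p)%VS]; split=> // x; rewrite inE => /eqP->.
    by exists (line_of p + line_of p)%VS; rewrite ?mem_head ?addvSl.
  by exists p, p; rewrite mem_head.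
have [|Vs [leVs sVs Vss]] := IHk s; first by rewrite /= in lt_s; lia.
exists ((line_of p + line_of q)%VS :: Vs); split=> //= x.
  rewrite !inE => /or3P[/eqP->|/eqP->|/sVs[V VVs xV]].
  - by exists (line_of p + line_of q)%VS; rewrite ?mem_head ?addvSl.
  - by exists (line_of p + line_of q)%VS; rewrite ?mem_head ?addvSr.
  - by exists V; rewrite // inE VVs orbT.
rewrite inE => /predU1P[->|/Vss[y [z [ys zs ->]]]].
  by exists p, q; rewrite !inE !eqxx ?orbT.
by exists y, z; rewrite !inE ys zs !orbT.
Qed.

(** One hyperplane for each pair of points. *)
Lemma form_through_points s (x : 'rV[K]_n.+1) e : x != 0 ->
  (forall p q, p \in s -> q \in s -> x \notin (line_of p + line_of q)%VS) ->
  (size s <= e.*2)%N ->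
  exists f, [/\ f \is e.-homog, forall p, p \in s -> f.[: vpick p] = 0
              & f.[: x] != 0].
Proof.
move=> nzx xs le_s; have [Vs [leVs sVs Vss]] := pair_spans s.
have [||V y|f [homf fV fx]] := @avoiding_form _ _ Vs [:: x] e.
- by rewrite (leq_trans leVs) // leq_uphalf_double.
- by move=> y; rewrite inE => /eqP->.
- by move/Vss => [p [q [ps qs ->]]]; rewrite inE => /eqP->; apply: xs.
exists f; split=> // [p /sVs[V VVs pV]|]; last by rewrite fx ?mem_head.
by apply: (fV V) => //; rewrite -ppoint_le.
Qed.

Section Tangent.
Variables (o : ppoint K n) (v : 'rV[K]_n.+1) (s : seq (ppoint K n)).
Local Notation L := (line_of o + <[v]>)%VS.
Hypotheses (vo : v \notin line_of o) (us : uniq s)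
  (sL : forall p, p \in s -> ~~ (line_of p <= L)%VS)
  (gen : forall V, (\dim V <= 3)%N ->
     (count (fun p => (line_of p <= V)%VS) (o :: s) <= \dim V)%N).

Lemma notin_of_off_line : o \notin s.
Proof. by apply/negP => /sL; rewrite addvSl. Qed.

Lemma neq_off_line p : p \in s -> o != p.
Proof. by move=> ps; apply: contraNneq notin_of_off_line => ->. Qed.

Lemma general_position_notin x p q : x \in o :: s -> p \in o :: s ->
  q \in o :: s -> x != p -> x != q -> vpick x \notin (line_of p + line_of q)%VS.
Proof.
move=> xs ps qs xp xq; apply/negP => x_pq.
have [pq|pq] := eqVneq p q.
  by move: x_pq; rewrite -pq addvv ppoint_eq_mem (negPf xp).
have dim2 := dim_span2 p q; have := leq_trans (gen (leqW dim2)) dim2.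
rewrite leqNgt -size_filter => /negP; apply.
apply: (@uniq_leq_size _ [:: x; p; q]).
  by rewrite /= !inE negb_or xp xq pq.
move=> y; rewrite !inE mem_filter => /or3P[]/eqP->.
- by rewrite ppoint_le x_pq.
- by rewrite addvSl.
- by rewrite addvSr.
Qed.

(** The conditions imposed by the scheme: the derivative at o along v, and the
    values at o and at the points of s. *)
Definition cond (i : nat) f : K :=
  match i with
  | 0 => dirderiv (vpick o) v f
  | 1 => f.[: vpick o]
  | j.+2 => f.[: vpick (nth o s j)]
  end.

Lemma condB i f g : cond i (f - g) = cond i f - cond i g.
Proof.
case: i => [|[|i]] /=; rewrite ?mevalB // -!along1E.
by rewrite rmorphB coefB.
Qed.

Lemma condZ i c f : cond i (c *: f) = c * cond i f.
Proof. by case: i => [|[|i]] /=; rewrite ?mevalZ // -!along1E alongZ coefZ. Qed.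

Lemma cond_sum i (I : Type) (r : seq I) F :
  cond i (\sum_(j <- r) F j) = \sum_(j <- r) cond i (F j).
Proof.
case: i => [|[|i]] /=; rewrite ?raddf_sum // -along1E rmorph_sum coef_sum.
by apply: eq_bigr => j _; rewrite /= along1E.
Qed.

(** The product of a hyperplane through L, which kills the value and the
    derivative at o, with a form through the other points. *)
Lemma form_at_point p e : p \in s -> (size s < e.*2)%N ->
  exists f, [/\ f \is e.-homog, cond 0 f = 0, f.[: vpick o] = 0
    & forall q, q \in s -> f.[: vpick q] = (q == p)%:R].
Proof.
case: e => // e ps; rewrite doubleS ltnS => lt_s.
have [a [aL nza]] := separating_linform (V := L) (x := vpick p)
  (etrans (congr1 negb (esym (ppoint_le _ _))) (sL ps)).
have mem_rem_s q : q \in rem p s = (q != p) && (q \in s).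
  by rewrite (mem_rem_uniq p us) inE.
have [|||f [homf fs fp]] := @form_through_points (rem p s) (vpick p) e.
- exact: vpick_neq0.
- move=> x y; rewrite !mem_rem_s => /andP[xp xs] /andP[yp ys].
  by apply: general_position_notin; rewrite ?inE ?xs ?ys ?ps ?orbT // eq_sym.
- by rewrite size_rem // -ltnS; move: lt_s; case: (size s) => [|k] /=; lia.
have ao : (linform a).[: vpick o] = 0.
  by apply: aL; rewrite -ppoint_le addvSl.
have av : (linform a).[: v] = 0 by apply: aL; rewrite memvE addvSr.
pose c := (linform a).[: vpick p] * f.[: vpick p].
have nzc : c != 0 by rewrite mulf_neq0.
exists (c^-1 *: (linform a * f)); split.
- exact/rpredZ/linformM_homog.
- by rewrite condZ /= dirderivM dirderiv_linform ao av !mul0r addr0 mulr0.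
- by rewrite mevalZ mevalM ao mul0r mulr0.
move=> q qs; rewrite mevalZ mevalM; have [->|qp] := eqVneq q p; first exact: mulVf.
by rewrite fs ?mulr0 // mem_rem_s qp.
Qed.

Lemma form_at_support e : (size s < e.*2)%N ->
  exists f, [/\ f \is e.-homog, f.[: vpick o] = 1
    & forall q, q \in s -> f.[: vpick q] = 0].
Proof.
move=> lt_s; have [|||f [homf fs fo]] := @form_through_points s (vpick o) e.
- exact: vpick_neq0.
- move=> x y xs ys.
  by apply: general_position_notin; rewrite ?inE ?xs ?ys ?eqxx ?orbT ?neq_off_line.
- exact: ltnW.
exists ((f.[: vpick o])^-1 *: f); split; first exact: rpredZ.
  by rewrite mevalZ mulVf.
by move=> q qs; rewrite mevalZ (fs q) // mulr0.
Qed.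

(** The product of a hyperplane through o and one point of s, transverse to L,
    with a form through the other points. *)
Lemma form_at_tangent e : (size s < e.*2)%N ->
  exists f, [/\ f \is e.-homog, cond 0 f = 1, f.[: vpick o] = 0
    & forall q, q \in s -> f.[: vpick q] = 0].
Proof.
case: e => // e; rewrite doubleS ltnS => lt_s; pose p := head o s.
have vp : v \notin (line_of o + line_of p)%VS.
  apply/negP => v_op; have LV : (L <= line_of o + line_of p)%VS.
    by rewrite subv_add addvSl -memvE.
  have ps : (p == o) || (p \in s).
    by rewrite /p; case: (s) => [|x s'] /=; rewrite ?eqxx ?mem_head ?orbT.
  case/orP: ps => [/eqP po|/sL]; first by case/negP: vo; rewrite po addvv in v_op.
  have /eqP -> : L == (line_of o + line_of p)%VS.
    by rewrite eqEdim LV (dim_tangent_line vo) dim_span2.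
  by rewrite addvSr.
have [a [aV av]] := separating_linform vp.
have [|||f [homf fs fo]] := @form_through_points (behead s) (vpick o) e.
- exact: vpick_neq0.
- move=> x y /mem_behead xs /mem_behead ys.
  by apply: general_position_notin; rewrite ?inE ?xs ?ys ?eqxx ?orbT ?neq_off_line.
- by rewrite size_behead; lia.
have ao : (linform a).[: vpick o] = 0.
  by apply: aV; rewrite -ppoint_le addvSl.
pose c := (linform a).[: v] * f.[: vpick o].
have nzc : c != 0 by rewrite mulf_neq0.
exists (c^-1 *: (linform a * f)); split.
- exact/rpredZ/linformM_homog.
- by rewrite condZ /= dirderivM dirderiv_linform ao mul0r addr0 mulVf.
- by rewrite mevalZ mevalM ao mul0r mulr0.
move=> q qs; rewrite mevalZ mevalM.
have : (q == p) || (q \in behead s).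
  by move: qs; rewrite /p; case: (s) => //= x s'; rewrite inE.
case/orP => [/eqP->|/fs->]; last by rewrite !mulr0.
by rewrite (aV (vpick p)) ?mul0r ?mulr0 // -ppoint_le addvSr.
Qed.

(** The bound on the degree leaves a hyperplane for each pair of points. *)
Lemma dual_forms e : (size s < e.*2)%N -> exists F : nat -> {mpoly K[n.+1]},
  forall i, (i < (size s).+2)%N -> F i \is e.-homog /\
    forall j, (j < (size s).+2)%N -> cond j (F i) = (j == i)%:R.
Proof.
move=> lt_s; have [Fv [homv vv vo' vs]] := form_at_tangent lt_s.
have [Fo [homo oo os]] := form_at_support lt_s.
pose dual i f := (i < (size s).+2)%N -> f \is e.-homog /\
  forall j, (j < (size s).+2)%N -> cond j f = (j == i)%:R.
suff /(@skolem _ _ dual) : forall i, exists f, dual i f by [].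
move=> [|[|i]].
- exists Fv => _; split=> // -[|[|j]] lt_j //=.
  by rewrite vs ?mem_nth.
- exists (Fo - cond 0 Fo *: Fv) => _; split=> [|[|[|j]] lt_j].
  + by rewrite rpredB // rpredZ.
  + by rewrite condB condZ vv mulr1 subrr.
  + by rewrite condB condZ /= oo vo' mulr0 subr0.
  + by rewrite condB condZ /= os ?vs ?mem_nth // mulr0 subr0.
- have [lt_i|le_i] := ltnP i (size s); last first.
    by exists 0; rewrite /dual !ltnS ltnNge le_i.
  have [f [homf f0 f1 fs]] := form_at_point (mem_nth o lt_i) lt_s.
  exists f => _; split=> // -[|[|j]] lt_j //=.
  by rewrite fs ?mem_nth // nth_uniq.
Qed.

End Tangent.
End GeneralPosition.

(** * Spans of points of the Veronese variety *)

Section VeroneseSpans.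
Variables (K : closedFieldType) (m d : nat).
Hypothesis d_ge2 : (2 <= d)%N.
Local Notation N := (veronese_dim m d).
Local Notation X := (veronese_variety K m d).
Implicit Types (f g : {mpoly K[m.+1]}) (x : ppoint K m) (P Q : ppoint K N).
Implicit Types (S : seq (ppoint K m)).

Lemma span_coefs (T : eqType) (V : vectType K) (F : T -> V) (s : seq T) u :
  uniq s -> u \in <<[seq F i | i <- s]>>%VS ->
  exists e : T -> K, u = \sum_(i <- s) e i *: F i.
Proof.
elim: s u => [|i s IHs] u /=.
  by rewrite span_nil memv0 => _ /eqP->; exists (fun=> 0); rewrite big_nil.
move=> /andP[si us]; rewrite span_cons => /memv_addP[_ /vlineP[c ->] [w ws ->]].
have [e ->] := IHs w us ws; exists (fun j => if j == i then c else e j).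
rewrite big_cons eqxx; congr (_ + _); rewrite [LHS]big_seq [RHS]big_seq.
by apply: eq_bigr => j sj; rewrite ifN //; apply: contraNneq si => <-.
Qed.

Lemma vpick_veronese x : exists2 c, c != 0 &
  vpick (veronese d x) = c *: veronese_vector d (vpick x).
Proof. exact: vpick_ppoint_of. Qed.

Lemma veronese_inj : injective (@veronese K m d).
Proof.
move=> x x' E; apply/eqP/negPn/negP => xx'.
have us : uniq [:: x; x'] by rewrite /= inE xx'.
have [F FP] := separating_forms us d_ge2.
have [homF Fx] := FP x (mem_head _ _).
have ap z : exists2 c, c != 0 &
    apolar (vpick (veronese d z)) (F x) = c * (F x).[: vpick z].
  have [c nzc ->] := vpick_veronese z; exists c => //.
  have := apolar_sum [:: tt] (fun=> c) (fun=> veronese_vector d (vpick z)) (F x).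
  by rewrite !big_seq1 (apolar_veronese _ homF).
have [c nzc Ec] := ap x; have [c' _ Ec'] := ap x'; move: Ec'; rewrite -E Ec.
rewrite !Fx ?inE ?eqxx ?orbT // eq_sym (negPf xx') mulr1 mulr0.
by move=> c0; rewrite c0 eqxx in nzc.
Qed.

Lemma mem_veronese_ppoint_of (V : {vspace 'rV[K]_N.+1}) v (nzv : v != 0) :
  veronese_vector d (vpick (ppoint_of nzv : ppoint K m)) \in V ->
  veronese_vector d v \in V.
Proof.
have [c nzc ->] := vpick_ppoint_of nzv.
by rewrite veronese_vectorZ rpredZeq expf_eq0 (negPf nzc) andbF.
Qed.

Lemma spanned_by_veronese S P : uniq S ->
  (forall V : {vspace 'rV[K]_N.+1},
     (forall x, x \in S -> veronese_vector d (vpick x) \in V) -> vpick P \in V) ->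
  spanned_by X P (size S).
Proof.
move=> us spanP; exists [seq veronese d x | x <- S]; split.
- by rewrite map_inj_uniq //; apply: veronese_inj.
- by rewrite size_map.
- by move=> _ /mapP[x _ ->]; exists x.
move=> V subV; rewrite ppoint_le; apply: spanP => x xS.
have : (line_of (veronese d x) <= V)%VS.
  by apply: sub_linear_point subV _; apply/on_reduced_points/map_f.
by rewrite ppoint_le; have [c nzc ->] := vpick_veronese x; rewrite rpredZeq (negPf nzc).
Qed.

Lemma spanned_by_evaluations P k : spanned_by X P k ->
  exists S e, [/\ uniq S, size S = k & forall f, f \is d.-homog ->
    apolar (vpick P) f = \sum_(x <- S) e x * f.[: vpick x]].
Proof.
move=> [s [us <- sX sP]].
have [S ES] : exists S, s = [seq veronese d x | x <- S].
  elim: s sX {us sP} => [|q s IHs] sX; first by exists [::].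
  have [|S ->] := IHs; first by move=> p ps; apply: sX; rewrite inE ps orbT.
  by have [x ->] := sX q (mem_head _ _); exists (x :: S).
have uS : uniq S by move: us; rewrite ES; apply: map_uniq.
have [e Ee] : exists e : ppoint K m -> K,
    vpick P = \sum_(x <- S) e x *: veronese_vector d (vpick x).
  apply: span_coefs uS _; rewrite -ppoint_le; apply: sP => f Vf k' p.
  rewrite ES => /mapP[x xS ->]; apply: Vf.
  rewrite ppoint_le; have [c _ ->] := vpick_veronese x; apply: memvZ.
  exact/memv_span/(map_f (fun z : ppoint K m => veronese_vector d (vpick z))).
exists S, e; split=> [//||f homf]; first by rewrite ES size_map.
rewrite Ee apolar_sum; apply: eq_bigr => x _.
by rewrite apolar_veronese.
Qed.

End VeroneseSpans.

(** * The rank and the border rank *)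

Lemma prod_homog1 (K : closedFieldType) n k (F : 'I_k -> {mpoly K[n]}) :
  (forall i, F i \is 1.-homog) -> \prod_i F i \is k.-homog.
Proof.
elim: k F => [|k IHk] F homF; first by rewrite big_ord0 dhomog1.
rewrite big_ord_recl; apply: (dhomogM (homF ord0)).
by apply: IHk => i; apply: homF.
Qed.

Section TangentSum.
Variables (K : closedFieldType) (m d : nat).
Local Notation N := (veronese_dim m d).
Local Notation X := (veronese_variety K m d).
Variables (o : ppoint K m) (v : 'rV[K]_m.+1) (s : seq (ppoint K m)).
Variables (c : ppoint K m -> K) (P : ppoint K N).
Local Notation L := (line_of o + <[v]>)%VS.
Hypotheses (charK0 : [pchar K] =i pred0) (d_ge2 : (2 <= d)%N).
Hypotheses (vo : v \notin line_of o) (us : uniq s)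
  (sL : forall p, p \in s -> ~~ (line_of p <= L)%VS)
  (gen : forall V : {vspace 'rV[K]_m.+1}, (\dim V <= 3)%N ->
     (count (fun p => (line_of p <= V)%VS) (o :: s) <= \dim V)%N).
Hypothesis apolarP : forall f, f \is d.-homog ->
  apolar (vpick P) f =
  dirderiv (vpick o) v f + \sum_(p <- s) c p * f.[: vpick p].
Implicit Types (f g : {mpoly K[m.+1]}) (x : ppoint K m).

(** The matrix of a sum of evaluations is the product of the values of the F_i
    and those of the G_j, and its rank is at most the number of evaluations. *)
Lemma catalecticant_rank k (F G : 'I_k -> {mpoly K[m.+1]}) (y : 'rV[K]_N.+1)
    (S : seq (ppoint K m)) (e : ppoint K m -> K) :
  (forall i j, F i * G j \is d.-homog) -> (size S < k)%N ->
  (forall f, f \is d.-homog -> apolar y f = \sum_(x <- S) e x * f.[: vpick x]) ->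
  \det (\matrix_(i, j) apolar y (F i * G j)) = 0.
Proof.
move=> homFG lt_S yS.
pose A := \matrix_(i < k, l < size S) (e (tnth (in_tuple S) l) * (F i).[: vpick (tnth (in_tuple S) l)]).
pose B := \matrix_(l < size S, j < k) (G j).[: vpick (tnth (in_tuple S) l)].
have -> : \matrix_(i, j) apolar y (F i * G j) = A *m B.
  apply/matrixP => i j; rewrite !mxE yS // big_tnth.
  by apply: eq_bigr => l _; rewrite !mxE mevalM mulrA.
apply/eqP; apply: contraT => detAB.
have unitAB : A *m B \in unitmx by rewrite unitmxE unitfE.
have := mxrankM_maxl A B; rewrite mxrank_unit // => le_k.
by have := leq_trans le_k (rank_leq_col A); rewrite leqNgt lt_S.
Qed.

Lemma det_linforms_homog k (a : 'I_k -> 'I_k -> 'rV[K]_N.+1) :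
  \det (\matrix_(i, j) linform (a i j)) \is k.-homog.
Proof.
apply: rpred_sum => p _; set D := \prod_i _.
have homD : D \is k.-homog.
  by apply: prod_homog1 => i; rewrite mxE linform_homog.
by case: (odd_perm p); rewrite ?mulN1r ?mul1r // rpredN.
Qed.

(** The permutation of the conditions pairing the value and the derivative at
    o, as the product rule does. *)
Definition swap01 i := match i with 0 => 1 | 1 => 0 | j => j end%N.

Definition weight i : K := if i is j.+2 then c (nth o s j) else 1.

Lemma apolar_dual_product i j f g : f * g \is d.-homog ->
  (i < (size s).+2)%N -> (j < (size s).+2)%N ->
  (forall k, (k < (size s).+2)%N -> cond o v s k f = (k == i)%:R) ->
  (forall k, (k < (size s).+2)%N -> cond o v s k g = (k == swap01 j)%:R) ->
  apolar (vpick P) (f * g) = (i == j)%:R * weight i.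
Proof.
move=> homfg lt_i lt_j fE gE; rewrite apolarP // dirderivM.
rewrite -[dirderiv _ _ f]/(cond o v s 0 f) -[dirderiv _ _ g]/(cond o v s 0 g).
rewrite -[f.[: _]]/(cond o v s 1 f) -[g.[: _]]/(cond o v s 1 g) !fE // !gE //.
rewrite (big_nth o) big_mkord.
under eq_bigr => k _ do
  rewrite mevalM -[f.[: _]]/(cond o v s k.+2 f) -[g.[: _]]/(cond o v s k.+2 g)
          fE ?gE ?ltnS //.
case: i lt_i fE => [|[|i]] lt_i fE.
- rewrite big1 => [|k _]; last by rewrite mul0r mulr0.
  by case: j lt_j gE => [|[|j]] _ _; rewrite /= ?(mul1r, mul0r, mulr0, addr0, add0r).
- rewrite big1 => [|k _]; last by rewrite mul0r mulr0.
  by case: j lt_j gE => [|[|j]] _ _; rewrite /= ?(mul1r, mul0r, mulr0, addr0, add0r).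
rewrite /= !mul0r !add0r (bigD1 (Ordinal (lt_i : (i < size s)%N))) //=.
rewrite big1 => [|k]; last first.
  by rewrite -val_eqE /= => /negPf ki; rewrite !eqSS ki mul0r mulr0.
rewrite eqxx mul1r addr0 mulrC; congr (_%:R * _).
by case: j {lt_j gE} => [|[|j]].
Qed.

(** The determinant of the functional on products of dual forms is a polynomial
    in the functional, diagonal with nonzero weights at P once the two
    conditions at o are exchanged. *)
Lemma border_rank_lower_bound k : (size s + 2 <= d)%N ->
  (forall p, p \in s -> c p != 0) ->
  on_scheme (secant_variety X k) P -> (size s + 2 <= k)%N.
Proof.
move=> le_d nzc secP; rewrite leqNgt; apply/negP => lt_k.
have [F FP] : exists F : nat -> {mpoly K[m.+1]}, forall i, (i < (size s).+2)%N ->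
    F i \is (d./2).-homog /\ forall j, (j < (size s).+2)%N ->
      cond o v s j (F i) = (j == i)%:R.
  by apply: dual_forms => //; lia.
have [G GP] : exists G : nat -> {mpoly K[m.+1]}, forall i, (i < (size s).+2)%N ->
    G i \is (d - d./2).-homog /\ forall j, (j < (size s).+2)%N ->
      cond o v s j (G i) = (j == i)%:R.
  by apply: dual_forms => //; lia.
have lt_swap i : (i < (size s).+2)%N -> (swap01 i < (size s).+2)%N.
  by case: i => [|[|i]].
have homFG (i j : 'I_(size s).+2) : F i * G (swap01 j) \is d.-homog.
  have := dhomogM (FP i (ltn_ord i)).1 (GP _ (lt_swap _ (ltn_ord j))).1.
  by rewrite subnKC //; lia.
pose a (i j : 'I_(size s).+2) : 'rV[K]_N.+1 :=
  \row_l (F i * G (swap01 j))@_(veronese_monomial l).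
pose D := \det (\matrix_(i, j) linform (a i j)).
have DE (y : 'rV[K]_N.+1) : D.[: y] =
    \det (\matrix_(i < (size s).+2, j < (size s).+2) apolar y (F i * G (swap01 j))).
  rewrite /D -[LHS]det_map_mx; congr determinant; apply/matrixP => i j.
  by rewrite !mxE /= -apolar_form_of -(homog_form_of (homFG i j)).
have : D.[: vpick P] = 0.
  apply: (on_scheme_eval secP).
  apply/(ideal_closure _ (det_linforms_homog a)) => Q spanQ.
  have [S [e [_ szS QE]]] := spanned_by_evaluations spanQ.
  by rewrite DE; apply: catalecticant_rank QE; rewrite // szS -addn2.
have -> : D.[: vpick P] = \det (diag_mx (\row_(i < (size s).+2) weight i)).
  rewrite DE; congr determinant; apply/matrixP => i j; rewrite !mxE.
  rewrite (@apolar_dual_product i j) ?homFG ?ltn_ord //.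
  - by rewrite mulr_natl mulrb -val_eqE; case: ifP.
  - by move=> k' lt_k'; rewrite (FP i (ltn_ord i)).2.
  - by move=> k' lt_k'; rewrite (GP _ (lt_swap _ (ltn_ord j))).2.
rewrite det_diag => /eqP; apply/negP/prodf_neq0 => i _; rewrite mxE.
case: i => [[|[|i]] lt_i] /=; rewrite ?oner_neq0 //.
by rewrite nzc ?mem_nth.
Qed.


Lemma line_point_neq0 z : vpick o + z *: v != 0.
Proof.
apply/eqP => z0; have zv : z *: v = - vpick o.
  by apply/eqP; rewrite -addr_eq0 addrC z0.
have : z *: v \in line_of o by rewrite zv memvN memv_pick.
rewrite rpredZeq (negPf vo) orbF => /eqP z00.
by move: z0; rewrite z00 scale0r addr0; apply/eqP/vpick_neq0.
Qed.

Definition line_point z : ppoint K m := ppoint_of (line_point_neq0 z).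

Lemma line_point_inj : injective line_point.
Proof.
move=> z z' E; have : vpick o + z *: v \in line_of (line_point z).
  exact: memv_line.
rewrite E => /vlineP[k Ek].
have Ezv : (z - k * z') *: v = (k - 1) *: vpick o.
  have zv : z *: v = k *: (vpick o + z' *: v) - vpick o.
    by rewrite -Ek addrAC subrr add0r.
  by rewrite !scalerBl scale1r zv scalerDr scalerA addrAC addrK.
have : (z - k * z') *: v \in line_of o by rewrite Ezv memvZ ?memv_pick.
rewrite rpredZeq (negPf vo) orbF => /eqP zk.
move/eqP: Ezv; rewrite zk scale0r eq_sym scaler_eq0 (negPf (vpick_neq0 o)) orbF.
rewrite subr_eq0 => /eqP k1; move/eqP: zk.
by rewrite k1 mul1r subr_eq0 => /eqP.
Qed.

Lemma line_point0 : line_point 0 = o.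
Proof.
by apply: val_inj; rewrite /= scale0r addr0 -ppoint_vline.
Qed.

Lemma line_point_notin z : line_point z \notin s.
Proof.
apply/negP => /sL; rewrite -memvE memvD //.
  by rewrite memvE -ppoint_vline addvSl.
by rewrite memvZ // memvE addvSr.
Qed.

(** The derivative is the value at t = 0 of the difference quotient of the
    Veronese map along the line, which is polynomial in t. *)
Lemma border_rank_upper_bound : on_scheme (secant_variety X (size s + 2)) P.
Proof.
pose q (i : 'I_N.+1) := along (vpick o) v ('X_[veronese_monomial i] : {mpoly K[m.+1]}).
pose w : 'rV[K]_N.+1 := \sum_(p <- s) c p *: veronese_vector d (vpick p).
pose Y i := drop_poly 1 (q i) + (w ord0 i)%:P.
pose z t : 'rV[K]_N.+1 := \row_i (Y i).[t].
have z0 : z 0 = vpick P.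
  apply/rowP => i; rewrite -(apolar_mon (vpick P)) apolarP; last by rewrite dhomogX /= mdeg_mon.
  rewrite mxE hornerD hornerC horner_coef0 coef_drop_poly add0n along1E.
  congr (_ + _); rewrite summxE; apply: eq_bigr => p _.
  by rewrite !mxE.
have zE t : t != 0 -> z t = t^-1 *: (veronese_vector d (vpick o + t *: v)
                                      - veronese_vector d (vpick o)) + w.
  move=> nzt; apply/rowP => i; rewrite !mxE hornerD hornerC; congr (_ + _).
  have -> : (drop_poly 1 (q i)).[t] = t^-1 * ((q i).[t] - (q i).[0]).
    have qE a : (q i).[a] = (q i)`_0 + (drop_poly 1 (q i)).[a] * a.
      rewrite -{1}(poly_take_drop 1 (q i)) hornerD hornerM hornerX.
      have -> : take_poly 1 (q i) = ((q i)`_0)%:P.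
        by apply/polyP => -[|j]; rewrite coef_take_poly coefC.
      by rewrite hornerC.
    by rewrite !qE mulr0 addr0 addrAC subrr add0r mulrC mulfK.
  by rewrite !horner_along scale0r addr0.
apply: on_schemeP => e g homg Ig.
have {}Ig Q : spanned_by X Q (size s + 2) -> g.[: vpick Q] = 0.
  by move/(ideal_closure _ homg): Ig; apply.
have /rV0Pn[i0 nzi0] := vpick_neq0 P.
pose G := mmap (@polyC K) Y g.
have GE t : G.[t] = g.[: z t].
  by rewrite horner_mmap; apply: meval_eq => i; rewrite mxE.
(* Y i0 discards the parameters at which the vector z t is zero. *)
have : G * Y i0 = 0.
  apply: poly0_of_nonzero_roots => t nzt; rewrite hornerM GE.
  have [z00|nzz] := eqVneq (z t) 0.
    have -> : (Y i0).[t] = z t ord0 i0 by rewrite mxE.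
    by rewrite z00 mxE mulr0.
  have [k nzk Ek] := vpick_ppoint_of nzz.
  have : g.[: vpick (ppoint_of nzz)] = 0.
    apply: Ig; have -> : (size s + 2 = size [:: line_point t, line_point 0 & s])%N.
      by rewrite /= addn2.
    apply: spanned_by_veronese => //.
      rewrite /= inE !(negPf (line_point_notin _)) us orbF !andbT.
      by rewrite (inj_eq line_point_inj).
    move=> V VS; rewrite Ek memvZ // zE // memvD //.
      apply: memvZ; apply: memvB.
        by apply: mem_veronese_ppoint_of (line_point_neq0 t) _; apply: VS; rewrite mem_head.
      by rewrite -line_point0; apply: VS; rewrite !inE eqxx orbT.
    rewrite /w big_seq; apply: memv_suml => p ps; apply: memvZ; apply: VS.
    by rewrite !inE ps !orbT.
  rewrite Ek (eval_homogZ _ _ homg) => /eqP; rewrite mulf_eq0 expf_eq0 (negPf nzk) andbF.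
  by move/eqP->; rewrite mul0r.
move/eqP; rewrite mulf_eq0 => /orP[/eqP G0|/eqP Y0].
  by rewrite -z0 -GE G0 horner0.
by case/negP: nzi0; rewrite -z0 mxE Y0 horner0.
Qed.

(** Weighting by the inverse of zeta ^+ k, here written zeta ^+ (k * d.-1),
    selects the exponents congruent to 1 modulo d: none but 1 is at most d. *)
Lemma coef1_roots_of_unity zeta (F : {poly K}) : d.-primitive_root zeta ->
  (size F <= d.+1)%N ->
  F`_1 = \sum_(k < d) zeta ^+ (k * d.-1) / d%:R * F.[zeta ^+ k].
Proof.
move=> prim szF; have nzd : d%:R != 0 :> K.
  by rewrite (iffLR (pcharf0P K) charK0); lia.
transitivity (\sum_(j < d.+1) F`_j / d%:R * \sum_(k < d) (zeta ^+ (d.-1 + j)) ^+ k); last first.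
  under eq_bigr do rewrite mulr_sumr.
  rewrite exchange_big; apply: eq_bigr => k _.
  rewrite (horner_coef_wide _ szF) mulr_sumr; apply: eq_bigr => j _.
  rewrite -!exprM mulnDl mulnC exprD [(j * k)%N]mulnC; ring.
have d1 : (1 < d.+1)%N by lia.
rewrite (bigD1 (Ordinal d1)) //= [X in _ + X]big1 ?addr0 => [|j].
  rewrite [X in _ * X](eq_bigr (fun=> 1)) => [|k _]; last first.
    by rewrite /= addn1 prednK ?(prim_expr_order prim) ?expr1n //; lia.
  by rewrite sumr_const card_ord divfK.
rewrite -val_eqE /= => j1; have nz1 : zeta ^+ (d.-1 + j) != 1.
  rewrite -(prim_order_dvd prim); apply/negP => /dvdnP[k Ek].
  have lt_j := ltn_ord j.
  have [k0|k1|k2] : [\/ k = 0%N, k = 1%N | (2 <= k)%N].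
    by case: k {Ek} => [|[|k]]; [constructor 1|constructor 2|constructor 3].
  - by rewrite k0 in Ek; lia.
  - by rewrite k1 in Ek; move/eqP: j1; lia.
  - by have := leq_mul k2 (leqnn d); lia.
have : (zeta ^+ (d.-1 + j) - 1) * \sum_(k < d) (zeta ^+ (d.-1 + j)) ^+ k = 0.
  by rewrite -subrX1 exprAC (prim_expr_order prim) expr1n subrr.
by move/eqP; rewrite mulf_eq0 subr_eq0 (negPf nz1) => /eqP->; rewrite mulr0.
Qed.

Lemma exists_prim_root : exists zeta : K, d.-primitive_root zeta.
Proof.
have nzd : d%:R != 0 :> K by rewrite (iffLR (pcharf0P K) charK0); lia.
have [r Dr] := closed_field_poly_normal ('X^d - 1 : {poly K}).
have d_gt0 : (0 < d)%N by lia.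
rewrite lead_coefXnsubC // scale1r in Dr.
have ur : uniq r by rewrite -separable_prod_XsubC -Dr separable_Xn_sub_1.
have szr : size r = d.
  by have := congr1 (fun p : {poly K} => size p) Dr; rewrite size_XnsubC // size_prod_XsubC => -[].
have /hasP[zeta _ prim] : has d.-primitive_root r.
  apply: has_prim_root; rewrite ?szr //.
  by apply/allP => x xr; rewrite /root_of_unity Dr root_prod_XsubC.
by exists zeta.
Qed.

(** Replace the derivative by d evaluations at the points o + zeta^k v of L. *)
Lemma rank_upper_bound : spanned_by X P (d + size s).
Proof.
have [zeta prim] := exists_prim_root.
pose S := [seq line_point (zeta ^+ k) | k <- iota 0 d] ++ s.
have -> : (d + size s = size S)%N by rewrite size_cat size_map size_iota.
apply: spanned_by_veronese => // [|V VS].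
  rewrite cat_uniq us andbT map_inj_in_uniq ?iota_uniq /=.
    apply/hasPn => p ps; apply/mapP => -[k _ Ep].
    by move: (line_point_notin (zeta ^+ k)); rewrite -Ep ps.
  move=> i j; rewrite !mem_iota /= add0n => lt_i lt_j /line_point_inj/eqP.
  by rewrite (eq_prim_root_expr prim) !modn_small // => /eqP.
have -> : vpick P =
    \sum_(k < d) (zeta ^+ (k * d.-1) / d%:R) *:
      veronese_vector d (vpick o + zeta ^+ k *: v) +
    \sum_(p <- s) c p *: veronese_vector d (vpick p).
  apply: apolar_ext => f homf.
  rewrite apolarDl !apolar_sum apolarP //; congr (_ + _); last first.
    by apply: eq_bigr => p _; rewrite apolar_veronese.
  rewrite -along1E (coef1_roots_of_unity prim (size_along _ _ homf)).
  by apply: eq_bigr => k _; rewrite horner_along apolar_veronese.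
apply: memvD.
  apply: memv_suml => k _; apply: memvZ.
  apply: mem_veronese_ppoint_of (line_point_neq0 _) _; apply: VS.
  by rewrite mem_cat; apply/orP; left; apply/mapP; exists (k : nat); rewrite ?mem_iota ?add0n /=.
rewrite big_seq; apply: memv_suml => p ps; apply: memvZ; apply: VS.
by rewrite mem_cat ps orbT.
Qed.

Lemma sum_subset (I : eqType) (U T : seq I) (F : I -> K) : uniq U -> uniq T ->
  {subset T <= U} -> \sum_(i <- U) (if i \in T then F i else 0) = \sum_(i <- T) F i.
Proof.
move=> uU uT TU; rewrite -big_mkcond -big_filter; apply/perm_big/uniq_perm => //.
  exact: filter_uniq.
by move=> i; rewrite mem_filter andb_idr //; apply: TU.
Qed.

(** Let w be the coefficients of the difference of the two decompositions, R the
    points of s and W those of both, other than o, with a nonzero coefficient.  A point of s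
    outside R belongs to S, and so does a point of W outside s; counting S
    bounds W. *)
Lemma rank_lower_bound k : (4 <= d)%N -> (size s + 2 <= d)%N ->
  (forall p, p \in s -> c p != 0) -> spanned_by X P k -> (d + size s <= k)%N.
Proof.
move=> d_ge4 le_d nzc /spanned_by_evaluations[S [e [uS <- eS]]].
rewrite leqNgt; apply/negP => lt_S.
pose w x := (if x \in s then c x else 0) - (if x \in S then e x else 0).
pose U := undup (s ++ S).
have uU : uniq U by apply: undup_uniq.
have sU : {subset s <= U} by move=> x xs; rewrite mem_undup mem_cat xs.
have SU : {subset S <= U} by move=> x xS; rewrite mem_undup mem_cat xS orbT.
pose W := [seq x <- U | (w x != 0) && (x != o)].
pose R := [seq x <- s | w x != 0].
have os : o \notin s := notin_of_off_line sL.
have rel : tangent_relation o v d W w.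
  split.
  - exact: filter_uniq.
  - by rewrite mem_filter eqxx andbF.
  - by move=> x; rewrite mem_filter => /andP[/andP[]].
  exists 1, (w o); split=> [|f homf]; first exact: oner_neq0.
  have sumU : \sum_(x <- U) w x * f.[: vpick x] = - dirderiv (vpick o) v f.
    transitivity (\sum_(x <- s) c x * f.[: vpick x] - \sum_(x <- S) e x * f.[: vpick x]).
      rewrite -(sum_subset _ uU us sU) -(sum_subset _ uU uS SU) -sumrB.
      apply: eq_bigr => x _; rewrite /w mulrBl; congr (_ - _).
        by case: ifP; rewrite ?mul0r.
      by case: ifP; rewrite ?mul0r.
    by rewrite -eS // apolarP //; ring.
  have -> : \sum_(x <- W) w x * f.[: vpick x] =
            \sum_(x <- U | x != o) w x * f.[: vpick x].
    rewrite big_filter big_mkcond [RHS]big_mkcond; apply: eq_bigr => x _.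
    by case: (x != o); rewrite ?andbT ?andbF //; case: eqVneq => //= ->; rewrite mul0r.
  have [oU|oU] := boolP (o \in U).
    by rewrite mul1r -addrA -(bigD1_seq o oU uU) sumU subrr.
  rewrite big_seq_cond (eq_bigl (fun x => x \in U)) => [|x]; last first.
    by rewrite andb_idr // => xU; apply: contraNneq oU => <-.
  rewrite -big_seq sumU /w (negPf os) ifN ?subr0 ?mul0r ?addr0 ?mul1r ?subrr //.
  by apply: contraNN oU; apply: SU.
apply: (@no_short_tangent_relation _ _ o v vo d W w R) => //.
- exact: filter_uniq.
- move=> x; rewrite !mem_filter => /andP[-> xs]; rewrite sU // andbT /=.
  by apply: contraNneq os => <-.
- by move=> p; rewrite mem_filter => /andP[_]; apply: sL.
- move=> V dimV; apply: leq_trans (gen dimV).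
  by rewrite /= leq_add2l leq_count_subseq // filter_subseq.
- by rewrite (leq_trans _ le_d) // leq_add2r size_filter count_size.
have sizeW : (size W <= size R + size [seq x <- W | x \notin s])%N.
  rewrite -(count_predC (mem s) W) [X in (_ <= _ + X)%N]size_filter leq_add2r.
  rewrite -size_filter uniq_leq_size ?filter_uniq // => x.
  by rewrite !mem_filter => /and3P[xs /andP[-> _] _]; exact: xs.
pose T := [seq x <- s | w x == 0].
have sizeS : (size ([seq x <- W | x \notin s] ++ T) <= size S)%N.
  apply: uniq_leq_size.
    rewrite cat_uniq !filter_uniq // andbT /=; apply/hasPn => x.
    by rewrite !mem_filter => /andP[_ ->].
  move=> x; rewrite mem_cat !mem_filter => /orP[/andP[xs /andP[_]]|/andP[]].
    by rewrite mem_undup mem_cat (negPf xs).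
  move=> + xs; rewrite /w xs; case: ifP => // _.
  by rewrite subr0 (negPf (nzc x xs)).
have sizeRT : (size T + size R = size s)%N.
  by rewrite !size_filter -(count_predC (fun x => w x == 0) s).
rewrite size_cat in sizeS.
have arith (a b u t x y : nat) : (a <= b + u)%N -> (u + t <= x)%N -> (t + b = y)%N ->
    (x < d + y)%N -> (a < d + b.*2)%N by lia.
exact: arith sizeW sizeS sizeRT lt_S.
Qed.

End TangentSum.

(** * The functional of a point in the span of the scheme *)

Section SpanFunctional.
Variables (K : closedFieldType) (m d : nat).
Implicit Types (f g : {mpoly K[m.+1]}) (B C : subscheme K m) (p o : ppoint K m).

Lemma sub_reduced_points C s :
  (forall p, p \in s -> on_scheme C p) -> sub_scheme (reduced_points s) C.
Proof.
move=> Cs f If e p ps; apply/(vanishes_homog p (pihomogP mdeg e f)).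
by apply: on_scheme_eval (Cs p ps) _; apply: ideal_homog.
Qed.

(** A form of degree d telling the schemes apart is a hyperplane telling their
    images apart. *)
Lemma proper_union_images B B' C C' f : sub_scheme B' B -> sub_scheme C' C ->
  f \is d.-homog -> ideal_of B' f -> ideal_of C' f ->
  ~ (ideal_of B f /\ ideal_of C f) ->
  proper_sub_scheme (union_scheme (veronese_image d B') (veronese_image d C'))
                    (union_scheme (veronese_image d B) (veronese_image d C)).
Proof.
move=> BB CC homf B'f C'f notf; split.
  by move=> g [Bg Cg]; split=> e; [apply/BB/Bg | apply/CC/Cg].
move=> sub; apply: notf; rewrite (homog_form_of homf) in B'f C'f *.
set a := \row_i _ in B'f C'f *.
have [|Ba Ca] := sub (linform a); first by split; apply/image_linform.
by split; apply/image_linform.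
Qed.

Lemma veronese_dim_gt0 : (0 < m)%N -> (0 < d)%N -> (0 < veronese_dim m d)%N.
Proof.
case: m d => // m' [|d'] // _ _; rewrite /veronese_dim -subn1 subn_gt0.
by rewrite addSn binS -addn1 leq_add ?bin_gt0 //; lia.
Qed.

End SpanFunctional.

Theorem theorem2 (K : closedFieldType) (charK0 : [pchar K] =i pred0)
    (m d t : nat) (m_ge3 : (3 <= m)%N) (d_ge5 : (5 <= d)%N)
    (t_ge3 : (3 <= t)%N) (t_le_d : (t <= d)%N)
    (L : {vspace 'rV[K]_m.+1}) (L_line : \dim L = 2%N)
    (A1 : subscheme K m) (A1_L : sub_scheme A1 (linear_scheme L))
    (A1_connected : connected_scheme A1) (A1_degree : has_degree A1 2)
    (A2 : seq (ppoint K m)) (A2_uniq : uniq A2) (A2_card : size A2 = (t - 2)%N)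
    (A2_notin_L : forall p, p \in A2 -> ~~ (line_of p <= L)%VS) :
  let A := union_scheme A1 (reduced_points A2) in
  let Z1 := veronese_image d A1 in
  let Z2 := veronese_image d (reduced_points A2) in
  let Z := union_scheme Z1 Z2 in
  let X := veronese_variety K m d in
  h1_ideal_vanishes A d ->
  linearly_general_position A ->
  forall P : ppoint K (veronese_dim m d),
    in_span Z P ->
    (forall Z' : subscheme K (veronese_dim m d),
       proper_sub_scheme Z' Z -> ~ in_span Z' P) ->
    has_border_rank X P t /\ has_rank X P (d + t - 2)%N.
Proof.
move=> A Z1 Z2 Z X _ lgp P spanP minP.
have sizeA2 : (size A2 + 2 = t)%N by rewrite A2_card subnK //; lia.
have [o [v [defL vo idealA1]]] := tangent_vector A1_L L_line A1_connected A1_degree.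
rewrite -ppoint_vline in defL vo.
have N_gt0 : (0 < veronese_dim m d)%N by apply: veronese_dim_gt0; lia.
have sL p : p \in A2 -> ~~ (line_of p <= line_of o + <[v]>)%VS.
  by rewrite -defL; apply: A2_notin_L.
have oA1 : on_scheme A1 o.
  apply: on_schemeP => e f homf /(idealA1 _ _ homf).
  by rewrite along_dvdX2 => /andP[/eqP].
have os : o \notin A2 := notin_of_off_line sL.
have gen (V : {vspace 'rV[K]_m.+1}) : (\dim V <= 3)%N ->
    (count (fun p => (line_of p <= V)%VS) (o :: A2) <= \dim V)%N.
  move=> dimV; apply: general_position_count lgp _ _ _.
  - by rewrite /= os.
  - move=> p; rewrite inE => /predU1P[->|pA2]; apply: on_union_scheme; [by left|right].
    exact/on_reduced_points.
  - by rewrite ltnS (leq_trans dimV).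
have [|F FP] := dual_forms vo A2_uniq sL gen (e := d); first by lia.
pose w i := apolar (vpick P) (F i).
have condA1 f : f \is d.-homog ->
    ideal_of A1 f <-> cond o v A2 0 f = 0 /\ cond o v A2 1 f = 0.
  move=> homf; rewrite (idealA1 _ _ homf) along_dvdX2.
  by split=> [/andP[/eqP ? /eqP ?]|[/= -> ->]]; rewrite ?eqxx.
have condA2 (s : seq (ppoint K m)) f : f \is d.-homog ->
    ideal_of (reduced_points s) f <-> forall p, p \in s -> f.[: vpick p] = 0.
  by move=> homf; apply: (ideal_closure _ homf).
have lt_index p : p \in A2 -> ((index p A2).+2 < (size A2).+2)%N.
  by rewrite !ltnS index_mem.
have val_cond p f : p \in A2 -> f.[: vpick p] = cond o v A2 (index p A2).+2 f.
  by move=> pA2; rewrite /= nth_index.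
have expand f : f \is d.-homog ->
    apolar (vpick P) f = \sum_(i < (size A2).+2) cond o v A2 i f * w i.
  move=> homf; pose g := \sum_(i < (size A2).+2) cond o v A2 i f *: F i.
  have homg : g \is d.-homog.
    by apply: rpred_sum => i _; apply: rpredZ; apply: (FP i (ltn_ord i)).1.
  have homfg : f - g \is d.-homog by rewrite rpredB.
  have cond0 j : (j < (size A2).+2)%N -> cond o v A2 j (f - g) = 0.
    move=> lt_j; rewrite condB cond_sum (bigD1 (Ordinal lt_j)) //= condZ.
    rewrite (FP j lt_j).2 // eqxx mulr1 big1 ?addr0 ?subrr // => i ij.
    rewrite condZ (FP i (ltn_ord i)).2 // -[j]/(nat_of_ord (Ordinal lt_j)).
    by rewrite val_eqE eq_sym (negPf ij) mulr0.
  have : apolar (vpick P) (f - g) = 0.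
    apply: (iffLR (in_span_images charK0 N_gt0 _ _ _) spanP) => //.
      by apply/condA1; rewrite ?cond0.
    by apply/condA2 => // p pA2; rewrite val_cond // cond0 ?lt_index.
  have -> : apolar (vpick P) (f - g) = apolar (vpick P) f - apolar (vpick P) g.
    exact: raddfB.
  move/eqP; rewrite subr_eq0 => /eqP ->; rewrite (raddf_sum (apolar (vpick P))).
  by apply: eq_bigr => i _; rewrite /= apolarZ.
(* Otherwise P is in the span of the image of o and A2. *)
have w0 : w 0%N != 0.
  apply/eqP => w00; have [homF FE] := FP 0%N isT.
  have F_A2 : ideal_of (reduced_points A2) (F 0%N).
    by apply/condA2 => // p pA2; rewrite val_cond // FE ?lt_index.
  apply: (minP (union_scheme (veronese_image d (reduced_points [:: o])) Z2)).
    apply: (proper_union_images (f := F 0%N)) => //.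
    - by apply: sub_reduced_points => p; rewrite inE => /eqP->.
    - by apply/condA2 => // p; rewrite inE => /eqP->; apply: (FE 1%N).
    - by case=> /(condA1 _ homF)[/eqP]; rewrite FE // eqxx oner_eq0.
  apply/in_span_images => // f homf /(condA2 _ _ homf) fo /(condA2 _ _ homf) fA2.
  rewrite expand // big_ord_recl w00 mulr0 add0r big1 // => i _.
  rewrite (_ : cond _ _ _ _ f = 0) ?mul0r //; case: i => [[|i] lt_i] /=.
    by rewrite fo ?mem_head.
  by rewrite fA2 ?mem_nth.
(* Otherwise the j-th point of A2 can be left out. *)
have wA2 j : (j < size A2)%N -> w j.+2 != 0.
  move=> lt_j; apply/eqP => wj; have [homF FE] := FP j.+2 lt_j.
  pose p := nth o A2 j; have pA2 : p \in A2 by apply: mem_nth.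
  have mem_rem_A2 q : (q \in rem p A2) = (q != p) && (q \in A2).
    by rewrite (mem_rem_uniq p A2_uniq) inE.
  apply: (minP (union_scheme Z1 (veronese_image d (reduced_points (rem p A2))))).
    apply: (proper_union_images (f := F j.+2)) => //.
    - apply: sub_reduced_points => q; rewrite mem_rem_A2 => /andP[_ qA2].
      exact/on_reduced_points.
    - by apply/condA1; rewrite ?FE.
    - apply/condA2 => // q; rewrite mem_rem_A2 => /andP[qp qA2].
      rewrite val_cond // FE ?lt_index // !eqSS.
      by case: eqP => // ij; move: qp; rewrite /p -ij nth_index ?eqxx.
    - case=> _ /(condA2 _ _ homF)/(_ p pA2)/eqP.
      by rewrite val_cond // FE ?lt_index // /p index_uniq // eqxx oner_eq0.
  apply/in_span_images => // f homf /(condA1 _ homf)[f0 f1] /(condA2 _ _ homf) fA2.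
  rewrite expand // big1 // => -[[|[|i]] lt_i] _; rewrite ?f0 ?f1 ?mul0r //=.
  have [->|ij] := eqVneq i j; first by rewrite wj mulr0.
  by rewrite fA2 ?mul0r // mem_rem_A2 mem_nth // nth_uniq // ij.
(* By Euler's identity the value at o is absorbed in the tangent vector. *)
pose u := w 0%N *: v + (w 1%N / d%:R) *: vpick o.
pose c p := w (index p A2).+2.
have nzd : d%:R != 0 :> K by rewrite (iffLR (pcharf0P K) charK0); lia.
have uo : u \notin line_of o.
  apply: contra vo => uo; have : w 0%N *: v \in line_of o.
    by rewrite -[_ *: v](addrK ((w 1%N / d%:R) *: vpick o)) memvB // memvZ ?memv_pick.
  by rewrite rpredZeq (negPf w0).
have uL p : p \in A2 -> ~~ (line_of p <= line_of o + <[u]>)%VS.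
  move/sL; apply: contra => /subv_trans; apply; rewrite subv_add addvSl -memvE /=.
  rewrite memvD // memvZ // memvE ?addvSr // -memvE.
  by rewrite (subvP (addvSl _ _)) ?memv_pick.
have apolarP f : f \is d.-homog -> apolar (vpick P) f =
    dirderiv (vpick o) u f + \sum_(p <- A2) c p * f.[: vpick p].
  move=> homf; rewrite expand // !big_ord_recl addrA; congr (_ + _).
    rewrite dirderivDZ dirderivZ (euler_homog _ homf) mulrA divfK //=.
    by rewrite mulrC [_ * w 1%N]mulrC.
  rewrite (big_nth o) big_mkord; apply: eq_bigr => i _.
  by rewrite /= mulrC /c index_uniq.
have nzc p : p \in A2 -> c p != 0 by move=> pA2; rewrite wA2 // index_mem.
have d_ge2 : (2 <= d)%N by lia.
have d_ge4 : (4 <= d)%N by lia.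
have le_d : (size A2 + 2 <= d)%N by rewrite sizeA2.
split; split.
- by rewrite -sizeA2; apply: (border_rank_upper_bound d_ge2 uo A2_uniq uL apolarP).
- move=> k; rewrite -sizeA2.
  exact: (border_rank_lower_bound d_ge2 uo A2_uniq uL gen apolarP le_d nzc).
- rewrite -addnBA -?A2_card; last by lia.
  exact: (rank_upper_bound charK0 d_ge2 uo A2_uniq uL apolarP).
- move=> k; rewrite -addnBA -?A2_card; last by lia.
  exact: (rank_lower_bound d_ge2 uo A2_uniq uL gen apolarP d_ge4 le_d nzc).
Qed.
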